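(* Let $(M,g)$ be a pseudo-Riemannian manifold of dimension $n\ge 3$ and let $T^2M$ be its second-order tangent bundle equipped with the pseudo-Riemannian metric $\overline g={}^{II}g+{}^{0}g$. Then $(T^2M,\overline g)$ is semi-symmetric if and only if $(M,g)$ is semi-symmetric.
   Context: All objects are of class $C^\infty$; repeated indices are summed. The second-order tangent bundle $T^2M$ of an $n$-dimensional manifold $M$ is the $3n$-dimensional manifold of all 2-jets at $0$ of maps $\mathbb R\to M$. A chart $(U,x^i)$ of $M$ induces coordinates $(x^i,y^i,z^i)$ on the preimage of $U$ in $T^2M$: for the 2-jet of a curve $F$, locally $x^i=F^i(t)$, one puts $x^i=F^i(0)$, $y^i=\frac{dF^i}{dt}(0)$, $z^i=\frac12\frac{d^2F^i}{dt^2}(0)$. The 0-th lift ${}^0c$ of a symmetric $(0,2)$-tensor field $c$ on $M$ is the $(0,2)$-tensor field on $T^2M$ whose matrix in the induced coordinates, ordered as $(x,y,z)$, is $\begin{pmatrix} c_{ij}&0&0\\0&0&0\\0&0&0\end{pmatrix}$; in particular ${}^0g$ is obtained with $c=g$. The 2-nd lift of $g$ is $${}^{II}g=\begin{pmatrix} z^s\partial_s g_{ij}+\frac12 y^ty^s\partial_t\partial_s g_{ij} & y^s\partial_s g_{ij} & g_{ij}\\ y^s\partial_s g_{ij}& g_{ij}&0\\ g_{ij}&0&0\end{pmatrix},\qquad \partial_i=\frac{\partial}{\partial x^i}.$$ Semi-symmetry: on a (pseudo-)Riemannian manifold of dimension $\ge3$ with Levi-Civita curvature $R$, for a $(0,k)$-tensor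 field $S$, $k\ge1$, put $(R(X,Y).S)(X_1,\dots,X_k)=-S(R(X,Y)X_1,X_2,\dots,X_k)-\dots-S(X_1,\dots,X_{k-1},R(X,Y)X_k)$. The manifold is called semi-symmetric if $R(X,Y).R=0$ for all vector fields $X,Y$, where the $R$ acted upon is the $(0,4)$-curvature tensor $R(X,Y,Z,W)=g(R(X,Y)Z,W)$. *)

(* Defs.v *)
From HB Require Import structures.
From mathcomp Require Import all_boot all_order all_algebra.
From mathcomp Require Import all_classical all_reals all_analysis.
Import Order.TTheory GRing.Theory Num.Theory.
Import numFieldNormedType.Exports.

Set Implicit Arguments.
Unset Strict Implicit.
Unset Printing Implicit Defensive.

Local Open Scope classical_set_scope.
Local Open Scope ring_scope.

(* The set [A] is meant to be open: the derivatives below are those of the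
   total function [f], and depend on [f] only near the point.  *)
Fixpoint Ck_on (R : realType) (V W : normedModType R) (A : set V) (k : nat)
    (f : V -> W) {struct k} : Prop :=
  if k is k'.+1 then
    (forall x, A x -> differentiable f x) /\
    (forall v, Ck_on A k' (fun x => 'D_v f x))
  else forall x, A x -> {for x, continuous f}.

Definition smooth_on (R : realType) (V W : normedModType R) (A : set V)
    (f : V -> W) : Prop :=
  forall k, Ck_on A k f.

Definition partial (R : realType) (n : nat) (W : normedModType R) (a : 'I_n)
    (f : 'rV[R]_n -> W) (x : 'rV[R]_n) : W :=
  'D_(delta_mx 0 a) f x.

(* A set together with local coordinates.  The topology of the set is the one
   for which all charts are homeomorphisms onto open sets.  [coord i] is a
   total function, but only its values on [dom i] are meaningful.  *)
Record atlas (R : realType) (n : nat) := Atlas {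
  point : Type;
  chart : Type;
  dom : chart -> set point;
  coord : chart -> point -> 'rV[R]_n
}.

Section Manifold.
Variables (R : realType) (n : nat) (M : atlas R n).

Definition img (i : chart M) : set 'rV[R]_n := coord i @` dom i.

Definition transition (i j : chart M) (x : 'rV[R]_n) : 'rV[R]_n :=
  xget 0 [set y | exists p, [/\ dom i p, dom j p, coord i p = x
                              & coord j p = y]].

Definition atlas_open (A : set (point M)) : Prop :=
  forall i : chart M, open (coord i @` (A `&` dom i)).

Definition atlas_hausdorff : Prop :=
  forall p q : point M, p <> q ->
    exists A B, [/\ atlas_open A, atlas_open B, A p, B q & A `&` B = set0].

Definition atlas_second_countable : Prop :=
  exists B : nat -> set (point M),
    (forall k, atlas_open (B k)) /\
    (forall A p, atlas_open A -> A p -> exists k, B k p /\ B k `<=` A).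

Record is_manifold : Prop := IsManifold {
  dom_cover : forall p : point M, exists i, dom i p;
  coord_inj : forall i : chart M, set_inj (dom i) (coord i);
  overlap_open : forall i j : chart M, open (coord i @` (dom i `&` dom j));
  transition_smooth : forall i j : chart M,
    smooth_on (coord i @` (dom i `&` dom j)) (transition i j);
  manifold_hausdorff : atlas_hausdorff;
  manifold_second_countable : atlas_second_countable
}.

(* A (0,2)-tensor field is given by its matrix in each chart, a function of the
   coordinates; only the values on [img i] are meaningful.  *)
Definition matrices : Type := chart M -> 'rV[R]_n -> 'M[R]_n.

(* ['J f x] acts on row vectors from the right: its (a, b) entry is the partial
   derivative of the b-th component of [f] along the a-th coordinate.  *)
Record is_pseudo_riemannian (g : matrices) : Prop := IsPseudoRiemannian {
  metric_smooth : forall i, smooth_on (img i) (g i);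
  metric_sym : forall i x, img i x -> (g i x)^T = g i x;
  metric_nondeg : forall i x, img i x -> g i x \in unitmx;
  metric_change : forall i j p, dom i p -> dom j p ->
    let J := 'J (transition i j) (coord i p) in
    g i (coord i p) = J *m g j (coord j p) *m J^T
}.

End Manifold.

(* Vector fields on a coordinate domain, by their components.  *)
Section LeviCivita.
Variables (R : realType) (n : nat) (G : 'rV[R]_n -> 'M[R]_n).

Definition vfield : Type := 'rV[R]_n -> 'rV[R]_n.
Implicit Types X Y Z W : vfield.

Definition lie_bracket X Y : vfield := fun x =>
  \row_k \sum_a (X x 0 a * partial a (fun u => Y u 0 k) x
               - Y x 0 a * partial a (fun u => X u 0 k) x).

Definition christoffel (k a b : 'I_n) (x : 'rV[R]_n) : R :=
  2^-1 * \sum_l invmx (G x) k l *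
    (partial a (fun u => G u b l) x + partial b (fun u => G u a l) x
     - partial l (fun u => G u a b) x).

Definition nabla X Y : vfield := fun x =>
  \row_k (\sum_a X x 0 a * partial a (fun u => Y u 0 k) x
        + \sum_a \sum_b christoffel k a b x * X x 0 a * Y x 0 b).

Definition curvature X Y Z : vfield := fun x =>
  nabla X (nabla Y Z) x - nabla Y (nabla X Z) x - nabla (lie_bracket X Y) Z x.

Definition curvature4 (Xs : 'I_4 -> vfield) : 'rV[R]_n -> R := fun x =>
  (curvature (Xs 0) (Xs 1) (Xs 2) x *m G x *m (Xs 3 x)^T) 0 0.

(* The derivation R(X, Y).S of a (0,k)-tensor field S.  *)
Definition curvature_act (k : nat) X Y (S : ('I_k -> vfield) -> 'rV[R]_n -> R) :
    ('I_k -> vfield) -> 'rV[R]_n -> R := fun Xs x =>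
  - \sum_(j < k) S (fun l => if l == j then curvature X Y (Xs j) else Xs l) x.

End LeviCivita.

(* The tensor identity R(X, Y).R = 0 is local, so it is tested on the smooth
   vector fields of each coordinate domain.  *)
Definition semi_symmetric (R : realType) (n : nat) (M : atlas R n)
    (g : matrices M) : Prop :=
  forall (i : chart M) (X Y : vfield R n) (Xs : 'I_4 -> vfield R n),
    smooth_on (img i) X -> smooth_on (img i) Y ->
    (forall l, smooth_on (img i) (Xs l)) ->
    forall x, img i x ->
      curvature_act (g i) X Y (curvature4 (g i)) Xs x = 0.

Section SecondOrderTangent.
Variables (R : realType) (n : nat) (M : atlas R n).

Definition smooth_curve (F : R -> point M) : Prop :=
  forall i : chart M,
    open (F @^-1` dom i) /\ smooth_on (F @^-1` dom i) (coord i \o F).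

(* The coordinates (x, y, z) of the 2-jet of F at 0.  *)
Definition curve_coord (i : chart M) (F : R -> point M) : 'rV[R]_(n + n + n) :=
  let f : R -> 'rV[R]_n := coord i \o F in
  row_mx (row_mx (f 0) (derive1 f 0)) (2^-1 *: derive1n 2 f 0).

Definition same_jet (F F' : R -> point M) : Prop :=
  F 0 = F' 0 /\
  forall i : chart M, dom i (F 0) -> curve_coord i F = curve_coord i F'.

(* 2-jets at 0 of smooth curves, as equivalence classes of curves.  *)
Definition jet : Type :=
  {J : set (R -> point M) | exists2 F, smooth_curve F
     & J = [set F' | smooth_curve F' /\ same_jet F F']}.

Definition jet_dom (i : chart M) : set jet :=
  [set J | exists2 F, sval J F & dom i (F 0)].

Definition jet_coord (i : chart M) (J : jet) : 'rV[R]_(n + n + n) :=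
  xget 0 [set u | exists2 F, sval J F & curve_coord i F = u].

Definition T2 : atlas R (n + n + n) :=
  @Atlas R (n + n + n) jet (chart M) jet_dom jet_coord.

Definition xpart (u : 'rV[R]_(n + n + n)) : 'rV[R]_n := lsubmx (lsubmx u).
Definition ypart (u : 'rV[R]_(n + n + n)) : 'rV[R]_n := rsubmx (lsubmx u).
Definition zpart (u : 'rV[R]_(n + n + n)) : 'rV[R]_n := rsubmx u.

Definition lift0 (c : matrices M) : matrices T2 := fun i u =>
  block_mx (block_mx (c i (xpart u)) 0 0 0) 0 0 0.

Definition lift2 (g : matrices M) : matrices T2 := fun i u =>
  let x := xpart u in let y := ypart u in let z := zpart u in
  let d s a b := partial s (fun v => g i v a b) in
  let A : 'M[R]_n := \matrix_(a, b)
    (\sum_s z 0 s * d s a b x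
     + 2^-1 * \sum_t \sum_s y 0 t * y 0 s * partial t (d s a b) x) in
  let B : 'M[R]_n := \matrix_(a, b) \sum_s y 0 s * d s a b x in
  block_mx (block_mx A B B (g i x)) (col_mx (g i x) 0) (row_mx (g i x) 0) 0.

Definition T2_metric (g : matrices M) : matrices T2 :=
  fun i u => lift2 g i u + lift0 g i u.

End SecondOrderTangent.

(* Main.v *)
From HB Require Import structures.
Require Import Defs.
From mathcomp Require Import all_boot all_order all_algebra.
From mathcomp Require Import all_classical all_reals all_analysis.
From mathcomp Require Import ring.

(** The second-order tangent bundle is the prolongation of the manifold by the
    algebra A of polynomials in e truncated at e^3 = 0 ([trunc3]).  A point of
    T2M with coordinates (x, y, z) is the A-point x + e y + e^2 z, and Taylor
    expansion turns a function f on M into the A-valued function [prolong f],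
    which is f(x + e y + e^2 z).  Prolongation respects sums and products
    ([prolongD], [prolongM]), and the derivative along the coordinate of T2M of
    block p in {0, 1, 2} above the coordinate i of M satisfies

       d_(i, p) (prolong f) = e^p (prolong (d_i f))      ([partial_prolong]);

    the factor e^p is called [weight] below, and i is called [base].

    Let [frob] be the linear form a_0 + a_1 e + a_2 e^2 |-> a_0 + a_2 on A.  In
    these terms the metric of the statement is

       gbar_((i, p), (j, q)) = frob (e^(p + q) prolong g_ij)   ([T2_metricE]):

    the coefficient a_2 yields the second lift and a_0 the 0-th lift.  All that
    matters about [frob] is that it is a Frobenius form: if frob (e^p a) = 0 for
    p = 0, 1, 2, then a = 0 ([frob_nondegenerate]).  Regarding tangent vectors
    of T2M as vectors with entries in A ([assemble]), nondegeneracy first gives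
    that gbar is invertible ([Gbar_unit]) and then that the Christoffel symbols
    of gbar are the prolonged Christoffel symbols of g ([christoffel_bar]),
    whatever Frobenius form was chosen.  Hence the curvature operator of gbar is
    the prolongation of that of g ([curv_bar]), and the tensor R.R of gbar is
    [frob] of the prolongation of the tensor R.R of g ([curv_curv_bar]).

    If R.R vanishes on M, so does its prolongation, hence R.R vanishes on T2M.
    Conversely, at the point (x, 0, 0), with five vectors in the first block and
    one in the third, the R.R of gbar is frob (e^2 prolong (R.R)), which is the
    value of R.R at x ([prolonged_semi_symmetricP]).

    What remains is of two kinds.  On the one hand, semi-symmetry, stated with
    vector fields, has to be reduced to components at a point
    ([semi_symmetric_onP]); this is the tensoriality of curvature and rests on
    the symmetry of second derivatives ([derive_comm]).  On the other hand, the
    chart of T2M over a chart domain must have the whole preimage as its image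
    ([img_T2]), so that it is open; for this every (x, y, z) is realised by a
    smooth curve that is defined on the whole real line and stays in the chart
    domain ([osc_curve]). *)

Import Order.TTheory GRing.Theory Num.Theory.
Import numFieldNormedType.Exports.

Set Implicit Arguments.
Unset Strict Implicit.
Unset Printing Implicit Defensive.

Local Open Scope classical_set_scope.
Local Open Scope ring_scope.

(** * Closure properties of smooth functions *)

Section DirectionalDerivatives.
Context {R : realType} {V W : normedModType R}.

Lemma derive_congr_on (A : set V) (f h : V -> W) (x v : V) :
  open A -> (forall y, A y -> f y = h y) -> A x -> 'D_v f x = 'D_v h x.
Proof.
move=> oA fh Ax; apply: near_eq_derive.
by near=> y; apply: fh; near: y; apply: open_nbhs_nbhs.
Unshelve. all: by end_near. Qed.

(** The difference of the two functions vanishes near the point, so that it is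
    differentiable there with zero differential. *)
Lemma differentiable_congr_on (A : set V) (f h : V -> W) (x : V) :
  open A -> (forall y, A y -> f y = h y) -> A x ->
  differentiable f x -> differentiable h x.
Proof.
move=> oA fh Ax df.
pose k : V -> W := h - f.
have k0 : \forall y \near x, k y = 0.
  near=> y; rewrite /k !fctE -fh ?subrr//.
  by near: y; apply: open_nbhs_nbhs.
have kE : k \o shift x = cst (k x) + (\0 : V -> W) +o_ 0 id.
  apply/eqaddoP => e e0; rewrite [\forall z \near _, _](near_shift x) sub0r.
  near=> y; rewrite !fctE /= subrK (near k0 y)// (nbhs_singleton k0).
  by rewrite addr0 subr0 normr0 mulr_ge0 // ltW.
have ck : continuous (\0 : {linear V -> W}) by move=> y; exact: cvg_cst.
have dk : differentiable k x.
  by apply/diff_locallyP; rewrite (diff_unique ck kE); split.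
rewrite (_ : h = f + k); last by apply/funext => y; rewrite /k !fctE subrKC.
exact: differentiableD.
Unshelve. all: by end_near. Qed.

End DirectionalDerivatives.

Section Smooth.
Context {R : realType}.
Implicit Types V W : normedModType R.

Lemma Ck_on_congr V W (A : set V) k (f h : V -> W) :
  open A -> (forall y, A y -> f y = h y) -> Ck_on A k f -> Ck_on A k h.
Proof.
move=> oA; elim: k f h => [|k IH] f h fh /=.
  move=> cf x Ax; rewrite /prop_for /continuous_at -(fh _ Ax).
  apply: cvg_trans (cf x Ax); apply: near_eq_cvg.
  by near=> y; apply: fh; near: y; apply: open_nbhs_nbhs.
move=> [df cf]; split=> [x Ax|v].
  exact: (differentiable_congr_on oA fh Ax (df x Ax)).
by apply: IH (cf v) => y Ay; exact: derive_congr_on oA fh Ay.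
Unshelve. all: by end_near. Qed.

Lemma Ck_onW V W (A : set V) k (f : V -> W) : Ck_on A k.+1 f -> Ck_on A k f.
Proof.
elim: k f => [|k IH] f [df cf]; last by split=> // v; exact: IH.
by move=> x Ax; exact: differentiable_continuous (df x Ax).
Qed.

Lemma Ck_on_sub V W (A B : set V) k (f : V -> W) :
  A `<=` B -> Ck_on B k f -> Ck_on A k f.
Proof.
move=> AB; elim: k f => [|k IH] f /=; first by move=> cf x /AB; exact: cf.
by move=> [df cf]; split=> [x /AB|v]; [exact: df|exact: IH].
Qed.

Lemma Ck_on_cst V W (A : set V) k (c : W) : Ck_on A k (fun _ : V => c).
Proof.
elim: k c => [|k IH] c; first by move=> x _; exact: cvg_cst.
split=> [x _|v]; first exact: differentiable_cst.
rewrite (_ : 'D_v _ = (fun _ => 0)); first exact: IH.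
by apply/funext => x; rewrite derive_cst.
Qed.

Lemma Ck_on_linear V W (A : set V) k (l : {linear V -> W}) :
  continuous l -> Ck_on A k l.
Proof.
move=> cl; case: k => [|k]; first by move=> x _; exact: cl.
split=> [x _|v]; first exact: linear_differentiable.
rewrite (_ : 'D_v _ = (fun _ => l v)); first exact: Ck_on_cst.
apply/funext => x; rewrite deriveE; first by rewrite diff_lin.
exact: linear_differentiable.
Qed.

Lemma derive_comp_linear V W (U : normedModType R) (l : {linear V -> W})
    (f : W -> U) (v x : V) : 'D_v (f \o l) x = 'D_(l v) f (l x).
Proof.
rewrite /derive; set p := (fun h : R => _); set q := (fun h : R => _).
suff -> : p = q by [].
by apply/funext => h; rewrite /p /q /= linearP.
Qed.

Lemma Ck_on_comp_linear V W (U : normedModType R) (A : set W) k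
    (l : {linear V -> W}) (f : W -> U) :
  continuous l -> Ck_on A k f -> Ck_on (l @^-1` A) k (f \o l).
Proof.
move=> cl; elim: k f => [|k IH] f /=.
  by move=> cf x Ax; apply: continuous_comp; [exact: cl|exact: cf].
move=> [df cf]; split=> [x Ax|v].
  by apply: differentiable_comp; [exact: linear_differentiable|exact: df].
rewrite (_ : 'D_v _ = 'D_(l v) f \o l); first exact/IH/cf.
by apply/funext => x; exact: derive_comp_linear.
Qed.

Lemma Ck_onD V W (A : set V) k (f h : V -> W) : open A ->
  Ck_on A k f -> Ck_on A k h -> Ck_on A k (fun x => f x + h x).
Proof.
move=> oA; elim: k f h => [|k IH] f h /=.
  by move=> cf ch x Ax; apply: continuousD; [exact: cf|exact: ch].
move=> [df cf] [dh ch]; split=> [x Ax|v].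
  by apply: (@differentiableD _ _ _ f h); [exact: df|exact: dh].
apply: (Ck_on_congr oA _ (IH _ _ (cf v) (ch v))) => x Ax.
by rewrite (@deriveD _ _ _ f h) //; apply: diff_derivable; [exact: df|exact: dh].
Qed.

Lemma Ck_onM V (A : set V) k (f h : V -> R) : open A ->
  Ck_on A k f -> Ck_on A k h -> Ck_on A k (fun x => f x * h x).
Proof.
move=> oA; elim: k f h => [|k IH] f h.
  by move=> /= cf ch x Ax; apply: continuousM; [exact: cf|exact: ch].
move=> Cf Ch; have [df cf] := Cf; have [dh ch] := Ch; split=> [x Ax|v].
  by apply: (@differentiableM _ _ f h); [exact: df|exact: dh].
have := Ck_onD oA (IH _ _ (Ck_onW Cf) (ch v)) (IH _ _ (Ck_onW Ch) (cf v)).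
apply: Ck_on_congr oA _ => x Ax.
by rewrite (@deriveM _ _ f h) //; apply: diff_derivable; [exact: df|exact: dh].
Qed.

(** Induction applies because the derivative - f' / f^2 of 1 / f is a product of
    f' and of two copies of 1 / f. *)
Lemma Ck_onV V (A : set V) k (f : V -> R) : open A ->
  (forall x, A x -> f x != 0) -> Ck_on A k f -> Ck_on A k (fun x => (f x)^-1).
Proof.
move=> oA f0; elim: k => [|k IH] Cf.
  by move=> /= x Ax; apply: continuousV; [exact: f0|exact: Cf].
have [df cf] := Cf; split=> [x Ax|v].
  by apply: differentiableV; [exact: df|exact: f0].
have Cf1 := IH (Ck_onW Cf).
have := Ck_onM oA (@Ck_on_cst V R A k (-1)) (Ck_onM oA (Ck_onM oA Cf1 Cf1) (cf v)).
apply: Ck_on_congr oA _ => x Ax.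
rewrite (@deriveV _ _ f) ?f0//; last exact/diff_derivable/df.
by rewrite mulN1r -invfM -expr2 -mulNr.
Qed.

(** Reduces the smoothness of fields of vectors and of matrices to that of
    scalar functions, for which products are available. *)
Lemma Ck_on_mxP V m n (A : set V) k (f : V -> 'M[R]_(m, n)) : open A ->
  Ck_on A k f <-> forall i j, Ck_on A k (fun x => f x i j).
Proof.
move=> oA; elim: k f => [|k IH] f /=.
  split=> [cf i j x Ax|cf x Ax].
    apply: (@continuous_comp _ _ _ f (fun M : 'M[R]_(m, n) => M i j)).
      exact: cf.
    exact: coord_continuous.
  apply/cvgrPdist_le => e e0; near=> y.
  rewrite [leLHS]/Num.Def.normr/= mx_normrE (bigmax_le _ (ltW e0))//= => i _.
  rewrite !mxE; move: i; near: y; apply: filter_forall => -[i j] /=.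
  exact: ((cvgrPdist_le _ _).1 (cf i j x Ax)).
split=> [[df cf] i j|cf].
  split=> [x Ax|v].
    apply: (@differentiable_comp _ _ _ _ f (fun M : 'M[R]_(m, n) => M i j)).
      exact: df.
    exact: differentiable_coord.
  apply: (Ck_on_congr oA _ ((IH _).1 (cf v) i j)) => x Ax.
  by rewrite derive_mx ?mxE//; exact/diff_derivable/df.
have df x : A x -> differentiable f x.
  move=> Ax; rewrite (_ : f = \sum_(i < m) \sum_(j < n)
      (fun x => f x i j *: (delta_mx i j : 'M[R]_(m, n)))); last first.
    apply/funext => y; rewrite [LHS]matrix_sum_delta fct_sumE.
    by apply: eq_bigr => i _; rewrite fct_sumE.
  apply: differentiable_sum => i; apply: differentiable_sum => j.
  by apply: differentiableZl; have [+ _] := cf i j; exact.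
split=> // v; apply/IH => i j; have [_ /(_ v)] := cf i j.
apply: Ck_on_congr oA _ => x Ax.
by rewrite (derive_mx (diff_derivable (df x Ax))) mxE.
Unshelve. all: by end_near. Qed.

End Smooth.

Section SmoothScalars.
Context {R : realType} {V : normedModType R}.
Implicit Types (U : set V) (f h : V -> R).

Lemma Ck_on_sum (I : Type) (r : seq I) (P : pred I) U k (F : I -> V -> R) :
  open U -> (forall i, P i -> Ck_on U k (F i)) ->
  Ck_on U k (fun x => \sum_(i <- r | P i) F i x).
Proof.
move=> oU CF; elim: r => [|i r IH].
  by under eq_fun do rewrite big_nil; exact: Ck_on_cst.
under eq_fun do rewrite big_cons.
case Pi : (P i); last by [].
by apply: Ck_onD => //; exact: CF.
Qed.

Lemma Ck_on_prod (I : Type) (r : seq I) (P : pred I) U k (F : I -> V -> R) :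
  open U -> (forall i, P i -> Ck_on U k (F i)) ->
  Ck_on U k (fun x => \prod_(i <- r | P i) F i x).
Proof.
move=> oU CF; elim: r => [|i r IH].
  by under eq_fun do rewrite big_nil; exact: Ck_on_cst.
under eq_fun do rewrite big_cons.
case Pi : (P i); last by [].
by apply: Ck_onM => //; exact: CF.
Qed.

End SmoothScalars.

Section SmoothOn.
Context {R : realType} {V : normedModType R}.
Implicit Types (U : set V) (f h : V -> R).

Lemma smooth_on_congr (W : normedModType R) U (f h : V -> W) : open U ->
  (forall y, U y -> f y = h y) -> smooth_on U f -> smooth_on U h.
Proof. by move=> oU fh sf k; exact: Ck_on_congr (sf k). Qed.

Lemma smooth_on_cst (W : normedModType R) U (c : W) : smooth_on U (fun _ : V => c).
Proof. by move=> k; exact: Ck_on_cst. Qed.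

Lemma smooth_onD U f h : open U ->
  smooth_on U f -> smooth_on U h -> smooth_on U (fun x => f x + h x).
Proof. by move=> oU sf sh k; exact: Ck_onD. Qed.

Lemma smooth_onM U f h : open U ->
  smooth_on U f -> smooth_on U h -> smooth_on U (fun x => f x * h x).
Proof. by move=> oU sf sh k; exact: Ck_onM. Qed.

Lemma smooth_onZ U (c : R) h : open U ->
  smooth_on U h -> smooth_on U (fun x => c * h x).
Proof. by move=> oU sh; apply: smooth_onM => //; exact: smooth_on_cst. Qed.

Lemma smooth_onN U f : open U -> smooth_on U f -> smooth_on U (fun x => - f x).
Proof.
move=> oU sf; apply: (smooth_on_congr oU _ (smooth_onZ (-1) oU sf)) => x _.
by rewrite mulN1r.
Qed.

Lemma smooth_onB U f h : open U ->
  smooth_on U f -> smooth_on U h -> smooth_on U (fun x => f x - h x).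
Proof. by move=> oU sf sh; apply: smooth_onD => //; exact: smooth_onN. Qed.

Lemma smooth_onV U f : open U -> (forall x, U x -> f x != 0) ->
  smooth_on U f -> smooth_on U (fun x => (f x)^-1).
Proof. by move=> oU f0 sf k; exact: Ck_onV. Qed.

Lemma smooth_on_sum (I : Type) (r : seq I) (P : pred I) U (F : I -> V -> R) :
  open U -> (forall i, P i -> smooth_on U (F i)) ->
  smooth_on U (fun x => \sum_(i <- r | P i) F i x).
Proof. by move=> oU sF k; apply: Ck_on_sum => // i /sF; exact. Qed.

Lemma smooth_on_prod (I : Type) (r : seq I) (P : pred I) U (F : I -> V -> R) :
  open U -> (forall i, P i -> smooth_on U (F i)) ->
  smooth_on U (fun x => \prod_(i <- r | P i) F i x).
Proof. by move=> oU sF k; apply: Ck_on_prod => // i /sF; exact. Qed.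

Lemma smooth_on_entry m n U (F : V -> 'M[R]_(m, n)) i j : open U ->
  smooth_on U F -> smooth_on U (fun x => F x i j).
Proof. by move=> oU sF k; exact: (Ck_on_mxP _ _ oU).1. Qed.

Lemma smooth_on_comp_linear (W : normedModType R) (A : set W)
    (l : {linear V -> W}) (f : W -> R) : continuous l ->
  smooth_on A f -> smooth_on (l @^-1` A) (f \o l).
Proof. by move=> cl sf k; exact: Ck_on_comp_linear. Qed.

Lemma smooth_on_derive U v f : smooth_on U f -> smooth_on U ('D_v f).
Proof. by move=> sf k; have [_] := sf k.+1; exact. Qed.

Lemma smooth_on_differentiable U f x :
  smooth_on U f -> U x -> differentiable f x.
Proof. by move=> sf Ux; have [+ _] := sf 1; exact. Qed.

Lemma deriveD_on U v f h x : smooth_on U f -> smooth_on U h -> U x ->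
  'D_v (fun y => f y + h y) x = 'D_v f x + 'D_v h x.
Proof.
move=> sf sh Ux; apply: (@deriveD _ _ _ f h).
  exact/diff_derivable/(smooth_on_differentiable sf).
exact/diff_derivable/(smooth_on_differentiable sh).
Qed.

Lemma deriveM_on U v f h x : smooth_on U f -> smooth_on U h -> U x ->
  'D_v (fun y => f y * h y) x = 'D_v f x * h x + f x * 'D_v h x.
Proof.
move=> sf sh Ux; rewrite (@deriveM _ _ f h).
- by rewrite addrC [h x *: _]mulrC.
- exact/diff_derivable/(smooth_on_differentiable sf).
exact/diff_derivable/(smooth_on_differentiable sh).
Qed.

Lemma smooth_on_det n U (F : V -> 'M[R]_n) : open U ->
  (forall i j, smooth_on U (fun x => F x i j)) -> smooth_on U (fun x => \det (F x)).
Proof.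
move=> oU sF; rewrite /determinant; apply: smooth_on_sum => // s _.
by apply: smooth_onZ => //; apply: smooth_on_prod.
Qed.

(** Cramer's rule. *)
Lemma smooth_on_invmx n U (F : V -> 'M[R]_n) i j : open U ->
  (forall x, U x -> F x \in unitmx) ->
  (forall i j, smooth_on U (fun x => F x i j)) ->
  smooth_on U (fun x => invmx (F x) i j).
Proof.
move=> oU uF sF.
have : smooth_on U (fun x => (\det (F x))^-1 *
    ((-1) ^+ (j + i) * \det (row' j (col' i (F x))))).
  apply: smooth_onM => //.
    apply: smooth_onV => // [x Ux|]; last exact: smooth_on_det.
    by have := uF x Ux; rewrite unitmxE unitfE.
  apply: smooth_onZ => //; apply: smooth_on_det => // a b.
  apply: (smooth_on_congr oU _ (sF (lift j a) (lift i b))) => x _.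
  by rewrite !mxE.
apply: smooth_on_congr => // x Ux.
by rewrite /invmx uF// !mxE.
Qed.

End SmoothOn.

(** * Symmetry of second derivatives *)

Section Schwarz.
Context {R : realType} {V : normedModType R}.
Implicit Types (f : V -> R) (v w x y : V).

Lemma is_derive_line f v y (s d : R) :
  is_derive (s *: v + y) v f d -> is_derive s 1 (fun s : R => f (s *: v + y)) d.
Proof.
move=> [df fd].
have e : (fun h : R => h^-1 *: ((fun s : R => f (s *: v + y)) (h *: (1 : R) + s)
           - f (s *: v + y))) =
         (fun h : R => h^-1 *: (f (h *: v + (s *: v + y)) - f (s *: v + y))).
  by apply/funext => h; rewrite /= scalerDl addrA [h *: 1]mulr1.
by apply: DeriveDef; rewrite /derivable /derive e.
Qed.

(** The mean value theorem is applied twice: in the direction v, to the increment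
    along h w, and then in the direction w, to the derivative along v. *)
Lemma second_difference_mean_value (U : set V) f v w x (h : R) :
  Ck_on U 2 f -> 0 < h ->
  (forall s t, 0 <= s <= h -> 0 <= t <= h -> U (t *: w + (s *: v + x))) ->
  exists s t, [/\ 0 <= s <= h, 0 <= t <= h &
    f (h *: v + (h *: w + x)) - f (h *: v + x) - (f (h *: w + x) - f x) =
    'D_w ('D_v f) (t *: w + (s *: v + x)) * (h * h)].
Proof.
move=> [df ddf] h0 hU.
pose phi s := f (s *: v + (h *: w + x)) - f (s *: v + x).
pose dphi s := 'D_v f (s *: v + (h *: w + x)) - 'D_v f (s *: v + x).
have swap s : s *: v + (h *: w + x) = h *: w + (s *: v + x) by rewrite addrCA.
have hh : 0 <= h <= h by rewrite lexx ltW.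
have U0 s : 0 <= s <= h -> U (s *: v + x).
  move=> sh; have := hU s 0 sh; rewrite scale0r add0r; apply.
  by rewrite lexx ltW.
have dphiP s : 0 <= s <= h -> is_derive s (1 : R) phi (dphi s).
  move=> sh.
  have line y : U (s *: v + y) ->
      is_derive s (1 : R) (fun s => f (s *: v + y)) ('D_v f (s *: v + y)).
    by move=> Uy; apply: is_derive_line; exact/derivableP/diff_derivable/df.
  have l1 := line (h *: w + x); rewrite swap in l1.
  have {l1} := is_deriveB (l1 (hU _ _ sh hh)) (line _ (U0 _ sh)).
  by rewrite /dphi swap.
have [s sh] : exists2 s, s \in `]0, h[%R & phi h - phi 0 = dphi s * (h - 0).
  apply: (@MVT R phi dphi 0 h h0) => [s|].
    by rewrite in_itv /= => /andP[s0 sh]; apply: dphiP; rewrite !ltW.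
  apply: derivable_within_continuous => s; rewrite in_itv /= => sh.
  by have [] := dphiP s sh.
rewrite {1 2}/phi subr0 !scale0r !add0r => ->.
move: sh; rewrite in_itv /= => /andP[s0 sh].
have {s0} sh : 0 <= s <= h by rewrite !ltW.
pose psi t := 'D_v f (t *: w + (s *: v + x)).
have [dDf _] := ddf v.
have psiP t : 0 <= t <= h ->
    is_derive t (1 : R) psi ('D_w ('D_v f) (t *: w + (s *: v + x))).
  move=> th; apply: (@is_derive_line ('D_v f)).
  by apply/derivableP/diff_derivable/dDf; exact: hU.
have [t th] : exists2 t, t \in `]0, h[%R &
    psi h - psi 0 = 'D_w ('D_v f) (t *: w + (s *: v + x)) * (h - 0).
  apply: (@MVT R psi (fun t => 'D_w ('D_v f) (t *: w + (s *: v + x))) 0 h h0)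
    => [t|].
    by rewrite in_itv /= => /andP[t0 th]; apply: psiP; rewrite !ltW.
  apply: derivable_within_continuous => t; rewrite in_itv /= => th.
  by have [] := psiP t th.
rewrite subr0 /psi scale0r add0r => psiE.
exists s, t; split=> //.
  by move: th; rewrite in_itv /= => /andP[/ltW-> /ltW->].
by rewrite /dphi swap psiE mulrA.
Qed.

(** The left-hand side is, up to regrouping, symmetric in v and w: this is what
    forces the two mixed derivatives to agree. *)
Lemma second_difference_cvg (U : set V) f v w x : open U -> Ck_on U 2 f -> U x ->
  (f (h *: v + (h *: w + x)) - f (h *: v + x) - (f (h *: w + x) - f x)) / (h * h)
    @[h --> (0 : R)^'+] --> 'D_w ('D_v f) x.
Proof.
move=> oU Cf Ux; apply/cvgrPdist_lt => e e0.
have [_ /(_ v) [_ /(_ w) cD]] := Cf.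
have /cvgrPdist_lt /(_ e e0) near1 := cD x Ux.
have near2 : \forall y \near x, U y by apply: open_nbhs_nbhs.
have /nbhs_ballP [d /= d0 dP] :
    nbhs x [set y | `|'D_w ('D_v f) x - 'D_w ('D_v f) y| < e /\ U y].
  exact: filterI near1 near2.
near=> h.
have h0 : 0 < h by near: h; exact: nbhs_right_gt.
(* The summand 1 covers the case v = w = 0. *)
have hd : h < d / (`|v| + `|w| + 1).
  near: h; apply: nbhs_right_lt; exact: divr_gt0.
have inball s t : 0 <= s <= h -> 0 <= t <= h -> ball x d (t *: w + (s *: v + x)).
  move=> /andP[s0 sh] /andP[t0 th]; rewrite -ball_normE /= distrC.
  rewrite addrA addrK (le_lt_trans (ler_normD _ _))// !normrZ !ger0_norm//.
  have n0 : 0 < `|v| + `|w| + 1 by rewrite ltr_wpDl// addr_ge0.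
  move: hd; rewrite ltr_pdivlMr// => /le_lt_trans; apply.
  rewrite mulrDr mulrDr addrC mulr1 -[leLHS]addr0 lerD ?(ltW h0)//.
  by rewrite lerD// ler_wpM2r.
have [s [t [sh th ->]]] : exists s t, [/\ 0 <= s <= h, 0 <= t <= h &
    f (h *: v + (h *: w + x)) - f (h *: v + x) - (f (h *: w + x) - f x) =
    'D_w ('D_v f) (t *: w + (s *: v + x)) * (h * h)].
  apply: (second_difference_mean_value Cf h0) => s t sh th.
  by have [] := dP _ (inball s t sh th).
rewrite mulfK ?mulf_neq0 ?gt_eqF//.
by have [] := dP _ (inball s t sh th).
Unshelve. all: by end_near. Qed.

Lemma derive_comm (U : set V) f v w x : open U -> Ck_on U 2 f -> U x ->
  'D_v ('D_w f) x = 'D_w ('D_v f) x.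
Proof.
move=> oU Cf Ux.
have c1 := second_difference_cvg (v := v) (w := w) oU Cf Ux.
have := second_difference_cvg (v := w) (w := v) oU Cf Ux.
rewrite (_ : (fun h : R => _) = (fun h : R =>
  (f (h *: v + (h *: w + x)) - f (h *: v + x) - (f (h *: w + x) - f x))
  / (h * h))); last first.
  apply/funext => h; rewrite [h *: w + (h *: v + x)]addrCA; congr (_ / _); ring.
by move=> c2; exact: (cvg_unique _ c2 c1).
Qed.

End Schwarz.

(** * Partial derivatives *)

Section Partial.
Context {R : realType} {n : nat}.
Implicit Types (U : set 'rV[R]_n) (f h : 'rV[R]_n -> R).

Lemma derive_partial f (x v : 'rV[R]_n) : differentiable f x ->
  'D_v f x = \sum_a v 0 a * partial a f x.
Proof.
move=> df; rewrite deriveE// {1}[v]row_sum_delta linear_sum.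
by apply: eq_bigr => a _; rewrite linearZ /partial deriveE.
Qed.

(** By the chain rule, a derivative of h o f is a sum of products of derivatives
    of the entries of f and of partial derivatives of h taken at f. *)
Lemma Ck_on_comp (V : normedModType R) (A : set V) U k (f : V -> 'rV[R]_n) h :
  open A -> (forall y, A y -> U (f y)) ->
  Ck_on A k f -> Ck_on U k h -> Ck_on A k (h \o f).
Proof.
move=> oA AU; elim: k h => [|k IH] h Cf Ch.
  move=> x Ax; apply: continuous_comp; first exact: Cf.
  exact/Ch/AU.
have [[df cf] [dh ch]] := (Cf, Ch).
split=> [x Ax|v].
  by apply: differentiable_comp; [exact: df|exact/dh/AU].
have : Ck_on A k (fun x => \sum_a 'D_v f x 0 a * (partial a h \o f) x).
  apply: Ck_on_sum => // a _; apply: Ck_onM => //.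
    by have /(Ck_on_mxP _ _ oA) := cf v; apply.
  by apply: IH; [exact: Ck_onW|exact: ch].
apply: Ck_on_congr => // x Ax /=; rewrite -derive_partial; last exact/dh/AU.
rewrite [RHS]deriveE; last first.
  by apply: differentiable_comp; [exact: df|exact/dh/AU].
rewrite (diff_comp (df x Ax) (dh _ (AU _ Ax))) /= -(deriveE v (df x Ax)).
by rewrite deriveE//; exact/dh/AU.
Qed.

End Partial.

Section PartialRules.
Context {R : realType} {n : nat}.
Variable U : set 'rV[R]_n.
Hypothesis oU : open U.
Implicit Types (f h : 'rV[R]_n -> R) (x : 'rV[R]_n) (a b : 'I_n).

Lemma smooth_on_partial a f : smooth_on U f -> smooth_on U (partial a f).
Proof. exact: smooth_on_derive. Qed.

Lemma partial_congr a f h x : (forall y, U y -> f y = h y) -> U x ->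
  partial a f x = partial a h x.
Proof. by move=> fh Ux; exact: derive_congr_on fh Ux. Qed.

Lemma partial_cst a c x : partial a (fun _ => c : R) x = 0.
Proof. exact: derive_cst. Qed.

Lemma partialD a f h x : smooth_on U f -> smooth_on U h -> U x ->
  partial a (fun y => f y + h y) x = partial a f x + partial a h x.
Proof. exact: deriveD_on. Qed.

Lemma partialM a f h x : smooth_on U f -> smooth_on U h -> U x ->
  partial a (fun y => f y * h y) x = partial a f x * h x + f x * partial a h x.
Proof. exact: deriveM_on. Qed.

Lemma partialZ a (c : R) h x : smooth_on U h -> U x ->
  partial a (fun y => c * h y) x = c * partial a h x.
Proof.
move=> sh Ux; rewrite partialM ?partial_cst ?mul0r ?add0r//.
exact: smooth_on_cst.
Qed.

Lemma partial_sum (I : Type) (r : seq I) (P : pred I) a (F : I -> _ -> R) x :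
  (forall i, P i -> smooth_on U (F i)) -> U x ->
  partial a (fun y => \sum_(i <- r | P i) F i y) x =
  \sum_(i <- r | P i) partial a (F i) x.
Proof.
move=> sF Ux; elim: r => [|i r IH].
  by under eq_fun do rewrite big_nil; rewrite big_nil partial_cst.
under eq_fun do rewrite big_cons.
rewrite big_cons; case Pi : (P i) => //.
by rewrite partialD ?IH//; [exact: sF|exact: smooth_on_sum].
Qed.

Lemma smooth_on_coord a : smooth_on U (fun x : 'rV[R]_n => x 0 a).
Proof.
apply: (@smooth_on_entry _ _ 1 n U id 0 a oU) => k.
by apply: (@Ck_on_linear _ _ _ U k idfun) => x; exact: cvg_id.
Qed.

Lemma partial_coord a b x : partial a (fun y => y 0 b) x = (a == b)%:R.
Proof.
have := derive_mx (@derivable_id _ _ x (delta_mx 0 a)).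
rewrite derive_id => /(congr1 (fun M : 'rV[R]_n => M 0 b)).
by rewrite !mxE /= eq_sym => ->.
Qed.

Lemma partial_comm a b f x : smooth_on U f -> U x ->
  partial a (partial b f) x = partial b (partial a f) x.
Proof. by move=> sf Ux; exact: derive_comm oU (sf 2) Ux. Qed.

End PartialRules.

(** * Multilinear algebra of curvature-like tensors *)

Section CurvatureAlgebra.
Variables (S : comNzRingType) (n : nat).
Implicit Types (c : 'I_n -> 'I_n -> 'I_n -> 'I_n -> S) (G : 'M[S]_n).
Implicit Types (p q u v w z : 'rV[S]_n) (s : S).

(** The coefficient c a b k d is the d-th component of the image of the basis
    vectors a, b, k.  The scalars form an arbitrary ring because the same
    expressions are needed over the reals and over truncated polynomials. *)
Definition curv c u v w : 'rV[S]_n :=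
  \row_d \sum_a \sum_b \sum_k u 0 a * v 0 b * w 0 k * c a b k d.

Definition curv4 c G u v w z : S := (curv c u v w *m G *m z^T) 0 0.

(** The opposite of R(p, q).R, where R is given by its components c and by the
    metric G. *)
Definition curv_curv c G p q u v w z : S :=
  curv4 c G (curv c p q u) v w z + curv4 c G u (curv c p q v) w z
  + curv4 c G u v (curv c p q w) z + curv4 c G u v w (curv c p q z).

Lemma curv_linear1 c s p q v w :
  curv c (s *: p + q) v w = s *: curv c p v w + curv c q v w.
Proof.
apply/rowP => d; rewrite !mxE mulr_sumr -big_split; apply: eq_bigr => a _ /=.
rewrite mulr_sumr -big_split; apply: eq_bigr => b _ /=.
rewrite mulr_sumr -big_split; apply: eq_bigr => k _ /=.
by rewrite !mxE; ring.
Qed.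

Lemma curv_linear2 c s p q v w :
  curv c v (s *: p + q) w = s *: curv c v p w + curv c v q w.
Proof.
apply/rowP => d; rewrite !mxE mulr_sumr -big_split; apply: eq_bigr => a _ /=.
rewrite mulr_sumr -big_split; apply: eq_bigr => b _ /=.
rewrite mulr_sumr -big_split; apply: eq_bigr => k _ /=.
by rewrite !mxE; ring.
Qed.

Lemma curv_linear3 c s p q v w :
  curv c v w (s *: p + q) = s *: curv c v w p + curv c v w q.
Proof.
apply/rowP => d; rewrite !mxE mulr_sumr -big_split; apply: eq_bigr => a _ /=.
rewrite mulr_sumr -big_split; apply: eq_bigr => b _ /=.
rewrite mulr_sumr -big_split; apply: eq_bigr => k _ /=.
by rewrite !mxE; ring.
Qed.

Definition curv_linear := (curv_linear1, curv_linear2, curv_linear3).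

Lemma curv4_linear1 c G s p q v w z :
  curv4 c G (s *: p + q) v w z = s * curv4 c G p v w z + curv4 c G q v w z.
Proof.
by rewrite /curv4 curv_linear !(mulmxDl, =^~ scalemxAl) !mxE.
Qed.

Lemma curv4_linear2 c G s p q v w z :
  curv4 c G v (s *: p + q) w z = s * curv4 c G v p w z + curv4 c G v q w z.
Proof.
by rewrite /curv4 curv_linear !(mulmxDl, =^~ scalemxAl) !mxE.
Qed.

Lemma curv4_linear3 c G s p q v w z :
  curv4 c G v w (s *: p + q) z = s * curv4 c G v w p z + curv4 c G v w q z.
Proof.
by rewrite /curv4 curv_linear !(mulmxDl, =^~ scalemxAl) !mxE.
Qed.

Lemma curv4_linear4 c G s p q v w z :
  curv4 c G v w z (s *: p + q) = s * curv4 c G v w z p + curv4 c G v w z q.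
Proof.
by rewrite /curv4 linearP /= mulmxDr -scalemxAr !mxE.
Qed.

Definition curv4_linear :=
  (curv4_linear1, curv4_linear2, curv4_linear3, curv4_linear4).

Lemma curv_curv_linear6 c G s p q u v w z z' :
  curv_curv c G p q u v w (s *: z + z') =
  s * curv_curv c G p q u v w z + curv_curv c G p q u v w z'.
Proof. by rewrite /curv_curv !(curv_linear, curv4_linear); ring. Qed.

Lemma curv_curv_scale6 c G s p q u v w z :
  curv_curv c G p q u v w (s *: z) = s * curv_curv c G p q u v w z.
Proof.
have lin := curv_curv_linear6 c G.
have T0 : curv_curv c G p q u v w 0 = 0.
  by have := lin (-1) p q u v w 0 0; rewrite scaler0 addr0 mulN1r addNr.
by rewrite -[s *: z]addr0 lin T0 addr0.
Qed.

Lemma linear_form_eq0 (T : 'rV[S]_n -> S) :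
  (forall s u v, T (s *: u + v) = s * T u + T v) ->
  (forall j, T (delta_mx 0 j) = 0) -> forall u, T u = 0.
Proof.
move=> Tlin T0 u.
have T00 : T 0 = 0.
  have := Tlin (-1) 0 0; rewrite scaler0 addr0 => e.
  by rewrite e mulN1r addNr.
rewrite [u]row_sum_delta; elim/big_rec : _ => // j v _ Tv.
by rewrite Tlin T0 Tv mulr0 addr0.
Qed.

(** An expression that is linear in each of its six arguments vanishes as soon as
    it does on basis vectors. *)
Lemma curv_curv_eq0 c G :
  (forall i1 i2 i3 i4 i5 i6, curv_curv c G (delta_mx 0 i1) (delta_mx 0 i2)
     (delta_mx 0 i3) (delta_mx 0 i4) (delta_mx 0 i5) (delta_mx 0 i6) = 0) ->
  forall p q u v w z, curv_curv c G p q u v w z = 0.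
Proof.
move=> h p q u v w z.
move: p; apply: linear_form_eq0 => [s p p'|i1].
  by rewrite /curv_curv !(curv_linear, curv4_linear); ring.
move: q; apply: linear_form_eq0 => [s q q'|i2].
  by rewrite /curv_curv !(curv_linear, curv4_linear); ring.
move: u; apply: linear_form_eq0 => [s u u'|i3].
  by rewrite /curv_curv !(curv_linear, curv4_linear); ring.
move: v; apply: linear_form_eq0 => [s v v'|i4].
  by rewrite /curv_curv !(curv_linear, curv4_linear); ring.
move: w; apply: linear_form_eq0 => [s w w'|i5].
  by rewrite /curv_curv !(curv_linear, curv4_linear); ring.
move: z; apply: linear_form_eq0 => [s z z'|i6]; last exact: h.
exact: curv_curv_linear6.
Qed.

End CurvatureAlgebra.

Section CurvatureMorphism.
Variables (S S' : comNzRingType) (n : nat) (phi : {rmorphism S -> S'}).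
Implicit Types (c : 'I_n -> 'I_n -> 'I_n -> 'I_n -> S) (G : 'M[S]_n).
Implicit Types (p q u v w z : 'rV[S]_n).

Lemma map_curv c u v w : map_mx phi (curv c u v w) =
  curv (fun a b k d => phi (c a b k d)) (map_mx phi u) (map_mx phi v) (map_mx phi w).
Proof.
apply/rowP => d; rewrite !mxE rmorph_sum; apply: eq_bigr => a _ /=.
rewrite rmorph_sum; apply: eq_bigr => b _ /=.
rewrite rmorph_sum; apply: eq_bigr => k _ /=.
by rewrite !mxE !rmorphM.
Qed.

Lemma rmorph_curv4 c G u v w z : phi (curv4 c G u v w z) =
  curv4 (fun a b k d => phi (c a b k d)) (map_mx phi G)
    (map_mx phi u) (map_mx phi v) (map_mx phi w) (map_mx phi z).
Proof. by rewrite /curv4 -map_curv matrix.map_trmx -!map_mxM [RHS]mxE. Qed.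

Lemma rmorph_curv_curv c G p q u v w z : phi (curv_curv c G p q u v w z) =
  curv_curv (fun a b k d => phi (c a b k d)) (map_mx phi G) (map_mx phi p)
    (map_mx phi q) (map_mx phi u) (map_mx phi v) (map_mx phi w) (map_mx phi z).
Proof. by rewrite /curv_curv -!map_curv -!rmorph_curv4 !rmorphD. Qed.

End CurvatureMorphism.

(** * Semi-symmetry in components *)

Definition semi_symmetric_on (R : realType) (n : nat) (U : set 'rV[R]_n)
    (G : 'rV[R]_n -> 'M[R]_n) : Prop :=
  forall (X Y : vfield R n) (Xs : 'I_4 -> vfield R n),
    smooth_on U X -> smooth_on U Y -> (forall l, smooth_on U (Xs l)) ->
    forall x, U x -> curvature_act G X Y (curvature4 G) Xs x = 0.

Section LocalCurvature.
Context {R : realType} {n : nat}.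
Variables (U : set 'rV[R]_n) (G : 'rV[R]_n -> 'M[R]_n).
Hypothesis oU : open U.
Hypothesis sG : forall a b, smooth_on U (fun x => G x a b).
Hypothesis uG : forall x, U x -> G x \in unitmx.

Local Notation gamma := (christoffel G).

(** Twice the Christoffel symbols of the first kind, with l the lowered index. *)
Definition christoffel_low (l a b : 'I_n) (x : 'rV[R]_n) : R :=
  partial a (fun u => G u b l) x + partial b (fun u => G u a l) x
  - partial l (fun u => G u a b) x.

(** The d-th component of R(a, b) k for coordinate vector fields a, b, k. *)
Definition riemann (a b k d : 'I_n) (x : 'rV[R]_n) : R :=
  partial a (gamma d b k) x - partial b (gamma d a k) x
  + \sum_l (gamma d a l x * gamma l b k x - gamma d b l x * gamma l a k x).

Lemma smooth_christoffel_low l a b : smooth_on U (christoffel_low l a b).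
Proof.
apply: smooth_onB => //; first apply: smooth_onD => //;
  exact: (smooth_on_partial _ (sG _ _)).
Qed.

Lemma smooth_christoffel d a b : smooth_on U (gamma d a b).
Proof.
apply: smooth_onZ => //; apply: smooth_on_sum => // l _.
apply: smooth_onM => //; first exact: smooth_on_invmx.
exact: smooth_christoffel_low.
Qed.

Lemma smooth_riemann a b k d : smooth_on U (riemann a b k d).
Proof.
apply: smooth_onD => //.
  by apply: smooth_onB => //; apply: smooth_on_partial; exact: smooth_christoffel.
apply: smooth_on_sum => // l _.
by apply: smooth_onB => //; apply: smooth_onM => //; exact: smooth_christoffel.
Qed.

Let smooth_vf (X : vfield R n) := forall a, smooth_on U (fun x => X x 0 a).

Lemma smooth_nabla X Y : smooth_vf X -> smooth_vf Y -> smooth_vf (nabla G X Y).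
Proof.
move=> sX sY d; under eq_fun do rewrite mxE.
apply: smooth_onD => //; apply: smooth_on_sum => // a _.
  by apply: smooth_onM => //; apply: smooth_on_partial.
apply: smooth_on_sum => // b _; apply: smooth_onM => //.
by apply: smooth_onM => //; exact: smooth_christoffel.
Qed.

(** Written as a sum over the same indices a and b as the expansion with X and Y
    exchanged, so that the two can be subtracted term by term. *)
Lemma nabla_nablaE X Y Z d x : smooth_vf X -> smooth_vf Y -> smooth_vf Z -> U x ->
  nabla G X (nabla G Y Z) x 0 d = \sum_a \sum_b (
    X x 0 a * partial a (fun u => Y u 0 b) x * partial b (fun u => Z u 0 d) x
    + X x 0 a * Y x 0 b * partial a (partial b (fun u => Z u 0 d)) x
    + \sum_k (X x 0 a * Y x 0 b * Z x 0 k * partial a (gamma d b k) x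
      + X x 0 a * partial a (fun u => Y u 0 b) x * Z x 0 k * gamma d b k x
      + X x 0 a * Y x 0 b * partial a (fun u => Z u 0 k) x * gamma d b k x
      + X x 0 a * Y x 0 b * partial b (fun u => Z u 0 k) x * gamma d a k x
      + \sum_l X x 0 a * Y x 0 b * Z x 0 k * gamma d a l x * gamma l b k x)).
Proof.
move=> sX sY sZ Ux; rewrite mxE.
have dE a : partial a (fun u => nabla G Y Z u 0 d) x = \sum_b (
    partial a (fun u => Y u 0 b) x * partial b (fun u => Z u 0 d) x
    + Y x 0 b * partial a (partial b (fun u => Z u 0 d)) x
    + \sum_k (Y x 0 b * Z x 0 k * partial a (gamma d b k) x
      + partial a (fun u => Y u 0 b) x * Z x 0 k * gamma d b k x
      + Y x 0 b * partial a (fun u => Z u 0 k) x * gamma d b k x)).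
  have sg := smooth_christoffel.
  under eq_fun do rewrite mxE.
  rewrite (@partialD _ _ U)//; last first.
  - apply: smooth_on_sum => // b _; apply: smooth_on_sum => // k _.
    by apply: smooth_onM => //; apply: smooth_onM.
  - apply: smooth_on_sum => // b _; apply: smooth_onM => //.
    exact: smooth_on_partial.
  rewrite !(partial_sum oU)//; last first.
  - by move=> b _; apply: smooth_onM => //; exact: smooth_on_partial.
  - move=> b _; apply: smooth_on_sum => // k _.
    by apply: smooth_onM => //; apply: smooth_onM.
  rewrite -big_split; apply: eq_bigr => b _ /=; congr (_ + _).
    by rewrite (@partialM _ _ U)//; exact: smooth_on_partial.
  rewrite (partial_sum oU)//; last first.
    by move=> k _; apply: smooth_onM => //; apply: smooth_onM.
  apply: eq_bigr => k _.
  rewrite (@partialM _ _ U)//; last by apply: smooth_onM.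
  by rewrite (@partialM _ _ U)//; ring.
rewrite -big_split; apply: eq_bigr => a _ /=; rewrite dE mulr_sumr.
have -> : \sum_l gamma d a l x * X x 0 a * nabla G Y Z x 0 l =
  \sum_b \sum_k (X x 0 a * Y x 0 b * partial b (fun u => Z u 0 k) x * gamma d a k x
      + \sum_l X x 0 a * Y x 0 b * Z x 0 k * gamma d a l x * gamma l b k x).
  rewrite exchange_big /=.
  transitivity (\sum_l (\sum_b X x 0 a * Y x 0 b * partial b (fun u => Z u 0 l) x
      * gamma d a l x + \sum_b \sum_k
      X x 0 a * Y x 0 b * Z x 0 k * gamma d a l x * gamma l b k x)).
    apply: eq_bigr => l _; rewrite mxE mulrDr !mulr_sumr; congr (_ + _).
      by apply: eq_bigr => b _; ring.
    apply: eq_bigr => b _; rewrite mulr_sumr.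
    by apply: eq_bigr => k _; ring.
  rewrite big_split /= [X in _ + X]exchange_big /=.
  under [in RHS]eq_bigr do rewrite big_split /=.
  rewrite big_split /= ; congr (_ + _).
  rewrite [RHS]exchange_big /=; apply: eq_bigr => b _.
  by rewrite exchange_big.
rewrite -big_split; apply: eq_bigr => b _ /=.
rewrite !mulrDr -!addrA; congr (_ + _); first by rewrite mulrA.
congr (_ + _); first by rewrite mulrA.
rewrite mulr_sumr -big_split; apply: eq_bigr => k _ /=.
by rewrite !addrA; congr (_ + _); ring.
Qed.

(** Tensoriality: the terms with first derivatives of X and Y are those of the
    bracket, those with first derivatives of Z are symmetric in X and Y, and so
    are those with second derivatives of Z since partial derivatives commute. *)
Lemma curvatureE X Y Z x : smooth_vf X -> smooth_vf Y -> smooth_vf Z -> U x ->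
  curvature G X Y Z x =
  curv (fun a b k d => riemann a b k d x) (X x) (Y x) (Z x).
Proof.
move=> sX sY sZ Ux; apply/rowP => d.
rewrite /curvature 2!mxE [X in _ + X]mxE [X in _ + X + _]mxE.
have brE : nabla G (lie_bracket X Y) Z x 0 d = \sum_a \sum_b (
    (X x 0 a * partial a (fun u => Y u 0 b) x * partial b (fun u => Z u 0 d) x
     - Y x 0 b * partial b (fun u => X u 0 a) x * partial a (fun u => Z u 0 d) x)
    + \sum_k (X x 0 a * partial a (fun u => Y u 0 b) x * Z x 0 k * gamma d b k x
     - Y x 0 b * partial b (fun u => X u 0 a) x * Z x 0 k * gamma d a k x)).
  pose H1 (b : 'I_n) := partial b (fun u => Z u 0 d) x
    + \sum_k Z x 0 k * gamma d b k x.
  transitivity (\sum_b lie_bracket X Y x 0 b * H1 b).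
    rewrite mxE -big_split; apply: eq_bigr => b _ /=; rewrite mulrDr mulr_sumr.
    by congr (_ + _); apply: eq_bigr => k _; ring.
  transitivity (\sum_a \sum_b X x 0 a * partial a (fun u => Y u 0 b) x * H1 b
    - \sum_b \sum_a Y x 0 a * partial a (fun u => X u 0 b) x * H1 b).
    rewrite [X in X - _]exchange_big -sumrB; apply: eq_bigr => b _ /=.
    rewrite mxE -sumrB mulr_suml; apply: eq_bigr => a _; ring.
  rewrite -sumrB; apply: eq_bigr => a _; rewrite -sumrB; apply: eq_bigr => b _.
  rewrite /H1 !mulrDr opprD addrACA; congr (_ + _).
  by rewrite !mulr_sumr -sumrB; apply: eq_bigr => k _; ring.
rewrite brE (nabla_nablaE d sX sY sZ Ux) (nabla_nablaE d sY sX sZ Ux).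
rewrite [X in _ - X - _]exchange_big [RHS]mxE -!sumrB /=.
apply: eq_bigr => a _; rewrite -!sumrB; apply: eq_bigr => b _.
(* The terms outside the sums over k cancel. *)
rewrite (partial_comm oU b a (sZ d) Ux).
match goal with |- (_ + _ + ?P) - (_ + _ + ?Q) - (_ + ?T) = _ =>
  transitivity (P - Q - T); first move: P Q T end.
  move: (partial a (partial b _) x) (partial b (fun u => Z u 0 d) x)
    (partial a (fun u => Z u 0 d) x) (partial a _ x) (partial b _ x) => *; ring.
rewrite -!sumrB; apply: eq_bigr => k _; rewrite /riemann mulrDr.
have -> : X x 0 a * Y x 0 b * Z x 0 k *
    (\sum_l (gamma d a l x * gamma l b k x - gamma d b l x * gamma l a k x)) =
  \sum_l X x 0 a * Y x 0 b * Z x 0 k * gamma d a l x * gamma l b k x -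
  \sum_l Y x 0 b * X x 0 a * Z x 0 k * gamma d b l x * gamma l a k x.
  by rewrite mulr_sumr -sumrB; apply: eq_bigr => l _; ring.
move: (\sum_l _) (\sum_l _) (partial a (fun u => Y u 0 b) x)
  (partial b (fun u => X u 0 a) x) (partial a (fun u => Z u 0 k) x)
  (partial b (fun u => Z u 0 k) x) (partial a _ x) (partial b _ x)
  (gamma d b k x) (gamma d a k x) => *.
move: (X x 0 a) (Y x 0 b) (Z x 0 k) => *; ring.
Qed.


Lemma smooth_curvature X Y Z : smooth_vf X -> smooth_vf Y -> smooth_vf Z ->
  smooth_vf (curvature G X Y Z).
Proof.
move=> sX sY sZ d.
have sL : smooth_vf (lie_bracket X Y).
  move=> k; under eq_fun do rewrite mxE.
  apply: smooth_on_sum => // a _; apply: smooth_onB => //;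
    by apply: smooth_onM => //; exact: smooth_on_partial.
under eq_fun do rewrite 2!mxE [X in _ + X]mxE [X in _ + X + _]mxE.
apply: smooth_onB => //; first apply: smooth_onB => //;
  by do ?apply: smooth_nabla.
Qed.

Lemma curvature_actE X Y Xs x : smooth_vf X -> smooth_vf Y ->
  (forall l, smooth_vf (Xs l)) -> U x ->
  curvature_act G X Y (curvature4 G) Xs x =
  - curv_curv (fun a b k d => riemann a b k d x) (G x) (X x) (Y x)
      (Xs 0 x) (Xs 1 x) (Xs 2 x) (Xs 3 x).
Proof.
move=> sX sY sXs Ux.
have c4E (Ys : 'I_4 -> vfield R n) : (forall l, smooth_vf (Ys l)) ->
  curvature4 G Ys x = curv4 (fun a b k d => riemann a b k d x) (G x)
    (Ys 0 x) (Ys 1 x) (Ys 2 x) (Ys 3 x).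
  by move=> sYs; rewrite /curvature4 curvatureE.
rewrite /curvature_act !big_ord_recl big_ord0 !c4E; first last.
- move=> l; case: ifP => _ //; exact: smooth_curvature.
- move=> l; case: ifP => _ //; exact: smooth_curvature.
- move=> l; case: ifP => _ //; exact: smooth_curvature.
- move=> l; case: ifP => _ //; exact: smooth_curvature.
have e1 : lift ord0 ord0 = 1 :> 'I_4 by apply/val_inj.
have e2 : lift ord0 (lift ord0 ord0) = 2 :> 'I_4 by apply/val_inj.
have e3 : lift ord0 (lift ord0 (lift ord0 ord0)) = 3 :> 'I_4 by apply/val_inj.
rewrite e1 e2 e3 /= addr0 !addrA /curv_curv.
by rewrite !curvatureE.
Qed.

(** Constant vector fields are enough to reach all values of R.R at a point. *)
Lemma semi_symmetric_onP : semi_symmetric_on U G <->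
  (forall x, U x -> forall p q u v w z,
     curv_curv (fun a b k d => riemann a b k d x) (G x) p q u v w z = 0).
Proof.
split=> [h x Ux p q u v w z|h X Y Xs sX sY sXs x Ux].
  pose Xs (l : 'I_4) : vfield R n := fun _ =>
    if l == 0 then u else if l == 1 then v else if l == 2 then w else z.
  have := h (fun _ => p) (fun _ => q) Xs; rewrite /Xs.
  move=> /(_ (smooth_on_cst _ _) (smooth_on_cst _ _) (fun _ => smooth_on_cst _ _)).
  move=> /(_ x Ux); rewrite curvature_actE//=.
  - by move=> /eqP; rewrite oppr_eq0 => /eqP.
  - by move=> a; exact: smooth_on_cst.
  - by move=> a; exact: smooth_on_cst.
  - by move=> l a; exact: smooth_on_cst.
rewrite curvature_actE ?h ?oppr0// => [a|a|l a]; exact: smooth_on_entry.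
Qed.

End LocalCurvature.

(** * Truncated polynomials *)

Section TruncatedPolynomials.
Variable S : comNzRingType.

(** Encodes a_0 + a_1 e + a_2 e^2, with e^3 = 0, by its coefficients. *)
Definition trunc3 : Type := (S * S * S)%type.
HB.instance Definition _ := GRing.Zmodule.copy trunc3 (S * S * S)%type.

Definition tcoef0 (a : trunc3) : S := a.1.1.
Definition tcoef1 (a : trunc3) : S := a.1.2.
Definition tcoef2 (a : trunc3) : S := a.2.

Definition trunc3_one : trunc3 := (1, 0, 0).
Definition trunc3_mul (a b : trunc3) : trunc3 :=
  (tcoef0 a * tcoef0 b, tcoef0 a * tcoef1 b + tcoef1 a * tcoef0 b,
   tcoef0 a * tcoef2 b + tcoef1 a * tcoef1 b + tcoef2 a * tcoef0 b).

Lemma trunc3P (a b : trunc3) :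
  tcoef0 a = tcoef0 b -> tcoef1 a = tcoef1 b -> tcoef2 a = tcoef2 b -> a = b.
Proof.
case: a => [[a0 a1] a2]; case: b => [[b0 b1] b2].
by rewrite /tcoef0 /tcoef1 /tcoef2 /= => -> -> ->.
Qed.

Lemma tcoef0D a b : tcoef0 (a + b) = tcoef0 a + tcoef0 b. Proof. by []. Qed.
Lemma tcoef1D a b : tcoef1 (a + b) = tcoef1 a + tcoef1 b. Proof. by []. Qed.
Lemma tcoef2D a b : tcoef2 (a + b) = tcoef2 a + tcoef2 b. Proof. by []. Qed.

Lemma trunc3_mulA : associative trunc3_mul.
Proof.
by move=> a b c; apply: trunc3P; rewrite /trunc3_mul /tcoef0 /tcoef1 /tcoef2 /=; ring.
Qed.

Lemma trunc3_mulC : commutative trunc3_mul.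
Proof.
by move=> a b; apply: trunc3P; rewrite /trunc3_mul /tcoef0 /tcoef1 /tcoef2 /=; ring.
Qed.

Lemma trunc3_mul1 : left_id trunc3_one trunc3_mul.
Proof.
by move=> a; apply: trunc3P; rewrite /trunc3_mul /tcoef0 /tcoef1 /tcoef2 /=; ring.
Qed.

Lemma trunc3_mulDl : left_distributive trunc3_mul +%R.
Proof.
move=> a b c.
apply: trunc3P; rewrite ?(tcoef0D, tcoef1D, tcoef2D) /trunc3_mul /tcoef0 /tcoef1 /tcoef2 /=; ring.
Qed.

Lemma trunc3_one_neq0 : trunc3_one != 0.
Proof. by apply/eqP => /(congr1 tcoef0) /eqP; rewrite oner_eq0. Qed.

HB.instance Definition _ := GRing.Zmodule_isComNzRing.Build trunc3
  trunc3_mulA trunc3_mulC trunc3_mul1 trunc3_mulDl trunc3_one_neq0.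

Lemma tcoef0M a b : tcoef0 (a * b) = tcoef0 a * tcoef0 b. Proof. by []. Qed.
Lemma tcoef1M a b : tcoef1 (a * b) = tcoef0 a * tcoef1 b + tcoef1 a * tcoef0 b.
Proof. by []. Qed.
Lemma tcoef2M a b :
  tcoef2 (a * b) = tcoef0 a * tcoef2 b + tcoef1 a * tcoef1 b + tcoef2 a * tcoef0 b.
Proof. by []. Qed.
Lemma tcoef0N a : tcoef0 (- a) = - tcoef0 a. Proof. by []. Qed.
Lemma tcoef1N a : tcoef1 (- a) = - tcoef1 a. Proof. by []. Qed.
Lemma tcoef2N a : tcoef2 (- a) = - tcoef2 a. Proof. by []. Qed.

Lemma tcoef0_sum (I : Type) (r : seq I) (P : pred I) (F : I -> trunc3) :
  tcoef0 (\sum_(i <- r | P i) F i) = \sum_(i <- r | P i) tcoef0 (F i).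
Proof. by apply: (big_morph tcoef0). Qed.
Lemma tcoef1_sum (I : Type) (r : seq I) (P : pred I) (F : I -> trunc3) :
  tcoef1 (\sum_(i <- r | P i) F i) = \sum_(i <- r | P i) tcoef1 (F i).
Proof. by apply: (big_morph tcoef1). Qed.
Lemma tcoef2_sum (I : Type) (r : seq I) (P : pred I) (F : I -> trunc3) :
  tcoef2 (\sum_(i <- r | P i) F i) = \sum_(i <- r | P i) tcoef2 (F i).
Proof. by apply: (big_morph tcoef2). Qed.

Definition tcoefE :=
  (tcoef0D, tcoef1D, tcoef2D, tcoef0M, tcoef1M, tcoef2M, tcoef0N, tcoef1N, tcoef2N).
Definition tcoef_sum := (tcoef0_sum, tcoef1_sum, tcoef2_sum).

Definition tconst (c : S) : trunc3 := (c, 0, 0).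

(** The form a_2 alone corresponds to the second lift of a metric, and the form
    a_0 to its 0-th lift. *)
Definition frob (a : trunc3) : S := tcoef0 a + tcoef2 a.

Lemma frobD a b : frob (a + b) = frob a + frob b.
Proof. by rewrite /frob !tcoefE; ring. Qed.

Lemma frobB a b : frob (a - b) = frob a - frob b.
Proof. by rewrite /frob !tcoefE; ring. Qed.

Lemma frob_sum (I : Type) (r : seq I) (P : pred I) (F : I -> trunc3) :
  frob (\sum_(i <- r | P i) F i) = \sum_(i <- r | P i) frob (F i).
Proof. by rewrite /frob !tcoef_sum -big_split. Qed.

Lemma frob_cst c a : frob (tconst c * a) = c * frob a.
Proof. by rewrite /frob !tcoefE /tcoef0 /tcoef1 /tcoef2 /=; ring. Qed.

Lemma tcoef0_is_zmod_morphism : zmod_morphism (tcoef0 : trunc3 -> S).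
Proof. by []. Qed.
Lemma tcoef0_is_monoid_morphism : monoid_morphism (tcoef0 : trunc3 -> S).
Proof. by []. Qed.
HB.instance Definition _ :=
  GRing.isZmodMorphism.Build trunc3 S tcoef0 tcoef0_is_zmod_morphism.
HB.instance Definition _ :=
  GRing.isMonoidMorphism.Build trunc3 S tcoef0 tcoef0_is_monoid_morphism.

End TruncatedPolynomials.

(** * Tangent vectors of the second-order tangent bundle as truncated polynomials *)

Section Blocks.
Context {R : realType} {n : nat}.
Implicit Types (u v w : 'rV[R]_(n + n + n)) (i : 'I_(n + n + n)).

(** Sends a coordinate of T2M, in any of its three blocks, to the coordinate of M
    that it lies over. *)
Definition base i : 'I_n :=
  match fintype.split i with
  | inl j => match fintype.split j with inl k => k | inr k => k end
  | inr k => k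
  end.

(** 1, e or e^2 according to the block of the coordinate. *)
Definition weight i : trunc3 R :=
  match fintype.split i with
  | inl j => match fintype.split j with inl _ => 1 | inr _ => ((0, 1), 0) end
  | inr _ => ((0, 0), 1)
  end.

(** Identifies the tangent vectors of T2M with vectors over truncated
    polynomials, the block p being the coefficient of e^p. *)
Definition assemble u : 'rV[trunc3 R]_n :=
  \row_k (xpart u 0 k, ypart u 0 k, zpart u 0 k).

Lemma assembleE u k :
  assemble u 0 k = (xpart u 0 k, ypart u 0 k, zpart u 0 k).
Proof. by rewrite mxE. Qed.

Lemma xpart_is_linear : linear (@xpart R n).
Proof. by move=> s u v; rewrite /xpart !linearP. Qed.
HB.instance Definition _ :=
  GRing.isLinear.Build R _ _ _ (@xpart R n) xpart_is_linear.

Lemma ypart_is_linear : linear (@ypart R n).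
Proof. by move=> s u v; rewrite /ypart !linearP. Qed.
HB.instance Definition _ :=
  GRing.isLinear.Build R _ _ _ (@ypart R n) ypart_is_linear.

Lemma zpart_is_linear : linear (@zpart R n).
Proof. by move=> s u v; rewrite /zpart !linearP. Qed.
HB.instance Definition _ :=
  GRing.isLinear.Build R _ _ _ (@zpart R n) zpart_is_linear.

Lemma xpart_continuous : continuous (@xpart R n).
Proof.
move=> u; apply: (@continuous_comp _ _ _ lsubmx lsubmx);
  exact: continuous_lsubmx.
Qed.

(** The three blocks over the coordinate l of M add up to the l-th assembled
    component of v, which turns contractions on T2M into contractions on M. *)
Lemma sum_blocks (v : 'rV[R]_(n + n + n)) (h : 'I_n -> trunc3 R) :
  \sum_i tconst (v 0 i) * (weight i * h (base i)) = \sum_l assemble v 0 l * h l.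
Proof.
rewrite 2!big_split_ord /= -!big_split; apply: eq_bigr => l _ /=.
rewrite /weight /base !(unsplitK (inl _)) !(unsplitK (inr _)).
rewrite !mulrA -!mulrDl; congr (_ * _).
rewrite assembleE /xpart /ypart /zpart !mxE.
by apply: trunc3P; rewrite !tcoefE /tcoef0 /tcoef1 /tcoef2 /=; ring.
Qed.

Lemma assemble_inj : injective assemble.
Proof.
move=> u v e; rewrite -[u]hsubmxK -[v]hsubmxK -[lsubmx u]hsubmxK -[lsubmx v]hsubmxK.
have e' k : [/\ xpart u 0 k = xpart v 0 k, ypart u 0 k = ypart v 0 k
    & zpart u 0 k = zpart v 0 k].
  by have := congr1 (fun M : 'rV[trunc3 R]_n => M 0 k) e; rewrite !assembleE => -[].
by congr (row_mx (row_mx _ _) _); apply/rowP => k; have [] := e' k.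
Qed.

End Blocks.

(** * Prolongation of functions *)

(** Here d1, d2, d3 stand for the partial derivatives of a function of order 1, 2,
    3, (y, z) for the second-order jet of a curve and (ex, ey, ez) for a variation
    of the jet.  The left-hand side is the derivative of the second-order Taylor
    coefficient of the function along the curve; the right-hand side is a
    coefficient of a product of truncated polynomials. *)
Lemma second_order_chain_rule (F : numFieldType) n
    (y z ex ey ez : 'I_n -> F) (d1 : 'I_n -> F) (d2 : 'I_n -> 'I_n -> F)
    (d3 : 'I_n -> 'I_n -> 'I_n -> F) :
  (forall a b, d2 a b = d2 b a) -> (forall a b c, d3 a b c = d3 b c a) ->
  \sum_s (ez s * d1 s + z s * \sum_l ex l * d2 l s) +
  2^-1 * \sum_t \sum_s ((ey t * y s + y t * ey s) * d2 t s
    + y t * y s * \sum_l ex l * d3 l t s) =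
  \sum_l (ex l * (\sum_s z s * d2 s l + 2^-1 * \sum_t \sum_s y t * y s * d3 t s l)
    + ey l * (\sum_s y s * d2 s l) + ez l * d1 l).
Proof.
move=> d2C d3C.
pose A := \sum_l ez l * d1 l.
pose B := \sum_l \sum_s ex l * (z s * d2 s l).
pose C := \sum_l \sum_s ey l * (y s * d2 s l).
pose D := \sum_l \sum_t \sum_s ex l * (y t * y s * d3 t s l).
transitivity (A + B + 2^-1 * (C + C + D)).
  congr (_ + _ * _).
    rewrite /A /B exchange_big -big_split; apply: eq_bigr => s _ /=.
    rewrite mulr_sumr; congr (_ + _); apply: eq_bigr => l _.
    by rewrite mulrCA d2C.
  transitivity (\sum_t \sum_s (ey t * (y s * d2 s t) + ey s * (y t * d2 t s)
      + \sum_l ex l * (y t * y s * d3 t s l))).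
    apply: eq_bigr => t _; apply: eq_bigr => s _; congr (_ + _).
      by rewrite (d2C s t); ring.
    by rewrite mulr_sumr; apply: eq_bigr => l _; rewrite mulrCA d3C.
  under eq_bigr do rewrite 2!big_split /=.
  rewrite 2!big_split /= [X in _ + X + _]exchange_big /=; congr (_ + _).
  rewrite /D [RHS]exchange_big /=; apply: eq_bigr => t _.
  by rewrite exchange_big.
transitivity (B + 2^-1 * D + C + A); first by field.
rewrite /A /B /C /D mulr_sumr -!big_split; apply: eq_bigr => l _ /=.
rewrite mulrDr !mulr_sumr; congr (_ + _ + _ + _).
by apply: eq_bigr => t _; rewrite -mulr_sumr mulrCA.
Qed.

Section Prolongation.
Context {R : realType} {n : nat}.
Variable U : set 'rV[R]_n.
Hypothesis oU : open U.
Implicit Types (f h : 'rV[R]_n -> R) (v : 'rV[R]_n) (u : 'rV[R]_(n + n + n)).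

(** The Taylor coefficients at 0 of t |-> f(x + t y + t^2 z), for u = (x, y, z). *)
Definition prolong f u : trunc3 R :=
  (f (xpart u), 'D_(ypart u) f (xpart u),
   'D_(zpart u) f (xpart u) + 2^-1 * 'D_(ypart u) ('D_(ypart u) f) (xpart u)).

Let Ubar : set 'rV[R]_(n + n + n) := @xpart R n @^-1` U.

Lemma open_xpart_preimage : open Ubar.
Proof. by apply: open_comp => // u _; exact: xpart_continuous. Qed.

Lemma prolong_congr f h u : (forall y, U y -> f y = h y) -> U (xpart u) ->
  prolong f u = prolong h u.
Proof.
move=> fh Ux; rewrite /prolong (fh _ Ux).
have dE v x : U x -> 'D_v f x = 'D_v h x by exact: derive_congr_on oU fh.
by rewrite !(dE _ _ Ux) (derive_congr_on _ oU (dE (ypart u)) Ux).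
Qed.

Lemma prolong_cst c u : prolong (fun _ => c) u = tconst c.
Proof.
rewrite /prolong !derive_cst; congr (_, _, _).
rewrite (_ : 'D_(ypart u) _ = fun _ => 0) ?derive_cst ?mulr0 ?addr0//.
by apply/funext => x; rewrite derive_cst.
Qed.

Lemma prolongD f h u : smooth_on U f -> smooth_on U h -> U (xpart u) ->
  prolong (fun x => f x + h x) u = prolong f u + prolong h u.
Proof.
move=> sf sh Ux.
have dE v x : U x -> 'D_v (fun y => f y + h y) x = 'D_v f x + 'D_v h x.
  by move=> Ux'; exact: deriveD_on sf sh Ux'.
have dDE v : 'D_v ('D_v (fun y => f y + h y)) (xpart u) =
    'D_v ('D_v f) (xpart u) + 'D_v ('D_v h) (xpart u).
  rewrite (derive_congr_on v oU (dE v) Ux).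
  exact: deriveD_on (smooth_on_derive _ sf) (smooth_on_derive _ sh) Ux.
rewrite /prolong !dE// dDE.
move: ('D__ ('D__ f) _) ('D__ ('D__ h) _) ('D_(zpart u) f _) ('D_(zpart u) h _)
  ('D__ f _) ('D__ h _) (f _) (h _) => *.
by apply: trunc3P; rewrite ?tcoefE /tcoef0 /tcoef1 /tcoef2 /=; ring.
Qed.

Lemma prolongM f h u : smooth_on U f -> smooth_on U h -> U (xpart u) ->
  prolong (fun x => f x * h x) u = prolong f u * prolong h u.
Proof.
move=> sf sh Ux.
have dE v x : U x -> 'D_v (fun y => f y * h y) x = 'D_v f x * h x + f x * 'D_v h x.
  by move=> Ux'; exact: deriveM_on sf sh Ux'.
have sD v := (smooth_on_derive v sf, smooth_on_derive v sh).
have dDE v : 'D_v ('D_v (fun y => f y * h y)) (xpart u) =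
    'D_v ('D_v f) (xpart u) * h (xpart u) + 'D_v f (xpart u) * 'D_v h (xpart u)
    + ('D_v f (xpart u) * 'D_v h (xpart u)
       + f (xpart u) * 'D_v ('D_v h) (xpart u)).
  rewrite (derive_congr_on v oU (dE v) Ux).
  rewrite (deriveD_on v (smooth_onM oU (sD v).1 sh) (smooth_onM oU sf (sD v).2) Ux).
  by rewrite (deriveM_on v (sD v).1 sh Ux) (deriveM_on v sf (sD v).2 Ux).
rewrite /prolong !dE// dDE.
move: ('D__ ('D__ f) _) ('D__ ('D__ h) _) ('D_(zpart u) f _) ('D_(zpart u) h _)
  ('D__ f _) ('D__ h _) (f _) (h _) => *.
by apply: trunc3P; rewrite ?tcoefE /tcoef0 /tcoef1 /tcoef2 /=; field.
Qed.

(** The coordinate form, which is the one of the second lift. *)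
Lemma prolongE f u : smooth_on U f -> U (xpart u) ->
  prolong f u = (f (xpart u), \sum_s ypart u 0 s * partial s f (xpart u),
    \sum_s zpart u 0 s * partial s f (xpart u) + 2^-1 * \sum_t \sum_s
      ypart u 0 t * ypart u 0 s * partial t (partial s f) (xpart u)).
Proof.
move=> sf Ux; rewrite /prolong.
have dE (v x : 'rV[R]_n) : U x -> 'D_v f x = \sum_s v 0 s * partial s f x.
  by move=> Ux'; exact/derive_partial/(smooth_on_differentiable sf).
rewrite !dE//; congr (_, _, _ + _ * _).
rewrite derive_partial; last first.
  exact/(smooth_on_differentiable (smooth_on_derive _ sf)).
apply: eq_bigr => t _.
rewrite (partial_congr oU _ (fun y Uy => dE (ypart u) y Uy) Ux).
rewrite (partial_sum oU)//; last first.
  by move=> s _; apply: smooth_onZ => //; exact: smooth_on_partial.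
rewrite mulr_sumr; apply: eq_bigr => s _.
by rewrite (@partialZ _ _ U)// ?mulrA//; exact: smooth_on_partial.
Qed.

Lemma smooth_on_xpart f : smooth_on U f -> smooth_on Ubar (f \o @xpart R n).
Proof.
by apply: (smooth_on_comp_linear (l := @xpart R n)); exact: xpart_continuous.
Qed.

Lemma smooth_prolong f : smooth_on U f ->
  [/\ smooth_on Ubar (fun u => tcoef0 (prolong f u)),
      smooth_on Ubar (fun u => tcoef1 (prolong f u)) &
      smooth_on Ubar (fun u => tcoef2 (prolong f u))].
Proof.
move=> sf; have oUb := open_xpart_preimage.
have sy s : smooth_on Ubar (fun u => ypart u 0 s).
  by under eq_fun do rewrite /ypart !mxE; exact: smooth_on_coord.
have sz s : smooth_on Ubar (fun u => zpart u 0 s).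
  by under eq_fun do rewrite /zpart !mxE; exact: smooth_on_coord.
have sp s : smooth_on Ubar (fun u => partial s f (xpart u)).
  exact: (smooth_on_xpart (smooth_on_partial _ sf)).
have spp s t : smooth_on Ubar (fun u => partial s (partial t f) (xpart u)).
  exact: (smooth_on_xpart (smooth_on_partial _ (smooth_on_partial _ sf))).
split.
- exact: smooth_on_xpart.
- apply: (smooth_on_congr oUb
    (f := fun u => \sum_s ypart u 0 s * partial s f (xpart u))).
    by move=> u Uu; rewrite prolongE.
  by apply: smooth_on_sum => // s _; exact: smooth_onM.
apply: (smooth_on_congr oUb (f := fun u =>
    \sum_s zpart u 0 s * partial s f (xpart u) + 2^-1 * \sum_t \sum_s
      ypart u 0 t * ypart u 0 s * partial t (partial s f) (xpart u))).
  by move=> u Uu; rewrite prolongE.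
apply: smooth_onD => //; first by apply: smooth_on_sum => // s _; exact: smooth_onM.
apply: smooth_onZ => //; apply: smooth_on_sum => // t _.
apply: smooth_on_sum => // s _; apply: smooth_onM => //; exact: smooth_onM.
Qed.

Lemma partial_comp_xpart i f u : smooth_on U f -> Ubar u ->
  partial i (f \o @xpart R n) u =
  \sum_l xpart (delta_mx 0 i : 'rV[R]_(n + n + n)) 0 l * partial l f (xpart u).
Proof.
move=> sf Uu; rewrite /partial (derive_comp_linear (@xpart R n)).
exact/derive_partial/(smooth_on_differentiable sf).
Qed.

(** The chain rule for f(x + e y + e^2 z), in which a coordinate of block p enters
    through e^p; it needs the partial derivatives of f up to order 3 to commute. *)
Lemma partial_prolong i f u : smooth_on U f -> Ubar u ->
  (partial i (fun u => tcoef0 (prolong f u)) u,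
   partial i (fun u => tcoef1 (prolong f u)) u,
   partial i (fun u => tcoef2 (prolong f u)) u) =
  weight i * prolong (partial (base i) f) u.
Proof.
move=> sf Uu; have oUb := open_xpart_preimage.
pose e : 'rV[R]_(n + n + n) := delta_mx 0 i.
have -> : weight i * prolong (partial (base i) f) u =
    \sum_l assemble e 0 l * prolong (partial l f) u.
  rewrite -(sum_blocks _ (fun l => prolong (partial l f) u)) (bigD1 i)//=.
  rewrite [X in _ + X]big1 ?addr0 => [|j /negPf ji].
    by rewrite mxE !eqxx (_ : tconst _ = 1) ?mul1r.
  by rewrite mxE ji /= (_ : tconst _ = 0) ?mul0r.
have px h : smooth_on U h ->
    partial i (h \o @xpart R n) u = \sum_l xpart e 0 l * partial l h (xpart u).
  by move=> sh; exact: partial_comp_xpart.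
have py s : partial i (fun u => ypart u 0 s) u = ypart e 0 s.
  under eq_fun do rewrite /ypart !mxE.
  by rewrite partial_coord /ypart !mxE /= eq_sym.
have pz s : partial i (fun u => zpart u 0 s) u = zpart e 0 s.
  under eq_fun do rewrite /zpart !mxE.
  by rewrite partial_coord /zpart !mxE /= eq_sym.
have sy s : smooth_on Ubar (fun u => ypart u 0 s).
  by under eq_fun do rewrite /ypart !mxE; exact: smooth_on_coord.
have sz s : smooth_on Ubar (fun u => zpart u 0 s).
  by under eq_fun do rewrite /zpart !mxE; exact: smooth_on_coord.
have sp s : smooth_on U (partial s f) by exact: smooth_on_partial.
have spp s t : smooth_on U (partial s (partial t f)) by exact: smooth_on_partial.
have spx s := smooth_on_xpart (sp s).
have sppx s t := smooth_on_xpart (spp s t).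
pose d1 a := partial a f (xpart u).
pose d2 a b := partial a (partial b f) (xpart u).
pose d3 a b c := partial a (partial b (partial c f)) (xpart u).
have d2C a b : d2 a b = d2 b a by exact: (partial_comm oU a b sf Uu).
have d3C a b c : d3 a b c = d3 b c a.
  rewrite /d3 (partial_comm oU a b (sp c) Uu).
  by apply: (partial_congr oU b _ Uu) => y Uy; exact: (partial_comm oU a c sf Uy).
clearbody e; apply: trunc3P.
- rewrite tcoef0_sum -[LHS]/(partial i (f \o @xpart R n) u) px//.
  by apply: eq_bigr => l _; rewrite assembleE.
- rewrite tcoef1_sum /tcoef1 /=.
  rewrite (partial_congr oUb _ (h := fun u =>
    \sum_s ypart u 0 s * (partial s f \o @xpart R n) u))//; last first.
    by move=> w Uw; have e1 := congr1 (@tcoef1 R) (prolongE sf Uw).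
  rewrite (partial_sum oUb)//; last by move=> s _; exact: smooth_onM.
  transitivity (\sum_s (ypart e 0 s * d1 s +
    \sum_l ypart u 0 s * xpart e 0 l * d2 l s)).
    apply: eq_bigr => s _; rewrite (partialM i (sy s) (spx s) Uu) py (px _ (sp s)).
    by rewrite mulr_sumr; under eq_bigr do rewrite mulrA.
  rewrite big_split /= [X in _ + X]exchange_big -big_split; apply: eq_bigr => l _ /=.
  rewrite assembleE prolongE// addrC.
  transitivity (xpart e 0 l * (\sum_s ypart u 0 s * d2 s l)
    + ypart e 0 l * d1 l) => //.
  congr (_ + _); rewrite mulr_sumr; apply: eq_bigr => s _.
  by rewrite (d2C s l) mulrCA mulrA.
rewrite tcoef2_sum [LHS]/tcoef2 [LHS]/=.
rewrite (partial_congr oUb _ (h := fun u =>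
  \sum_s zpart u 0 s * (partial s f \o @xpart R n) u + 2^-1 * \sum_t \sum_s
    ypart u 0 t * ypart u 0 s * (partial t (partial s f) \o @xpart R n) u))//;
  last by move=> w Uw; have e2 := congr1 (@tcoef2 R) (prolongE sf Uw).
have syy t s : smooth_on Ubar (fun u => ypart u 0 t * ypart u 0 s).
  exact: smooth_onM.
have sz1 s : smooth_on Ubar (fun u => zpart u 0 s * (partial s f \o @xpart R n) u).
  exact: smooth_onM.
have sy2 t s : smooth_on Ubar
    (fun u => ypart u 0 t * ypart u 0 s * (partial t (partial s f) \o @xpart R n) u).
  exact: smooth_onM.
rewrite (@partialD _ _ Ubar)//; first last.
- apply: smooth_onZ => //; apply: smooth_on_sum => // t _.
  exact: smooth_on_sum.
- exact: smooth_on_sum.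
rewrite (@partialZ _ _ Ubar)//; last first.
  by apply: smooth_on_sum => // t _; exact: smooth_on_sum.
rewrite !(partial_sum oUb)//; last by move=> t _; exact: smooth_on_sum.
have -> : \sum_s partial i (fun u => zpart u 0 s * (partial s f \o @xpart R n) u) u
    = \sum_s (zpart e 0 s * d1 s + zpart u 0 s * \sum_l xpart e 0 l * d2 l s).
  apply: eq_bigr => s _.
  by rewrite (partialM i (sz s) (spx s) Uu) pz (px _ (sp s)).
have -> : \sum_t partial i (fun u => \sum_s ypart u 0 t * ypart u 0 s *
      (partial t (partial s f) \o @xpart R n) u) u =
    \sum_t \sum_s ((ypart e 0 t * ypart u 0 s + ypart u 0 t * ypart e 0 s) * d2 t s
      + ypart u 0 t * ypart u 0 s * \sum_l xpart e 0 l * d3 l t s).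
  apply: eq_bigr => t _; rewrite (partial_sum oUb)//; apply: eq_bigr => s _.
  rewrite (partialM i (syy t s) (sppx t s) Uu) (partialM i (sy t) (sy s) Uu).
  by rewrite !py (px _ (spp t s)).
rewrite (second_order_chain_rule _ _ _ _ _ d1 d2C d3C).
by apply: eq_bigr => l _; rewrite tcoef2M assembleE (prolongE (sp l) Uu).
Qed.

End Prolongation.

Section Lifts.
Context {R : realType} {n : nat}.
Variable U : set 'rV[R]_n.
Hypothesis oU : open U.
Variable u : 'rV[R]_(n + n + n).
Hypothesis Uu : U (xpart u).
Implicit Types (f h : 'rV[R]_n -> R) (F H : trunc3 R).

(** Pairs a truncated polynomial with a function that it is the prolongation of:
    the prolongation of an expression is computed by following its syntax, with
    the closure lemmas below. *)
Definition lifts F f : Prop := smooth_on U f /\ F = prolong f u.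

Lemma lifts_prolong f : smooth_on U f -> lifts (prolong f u) f.
Proof. by []. Qed.

Lemma lifts_cst c : lifts (tconst c) (fun _ => c).
Proof. by split; [exact: smooth_on_cst|rewrite prolong_cst]. Qed.

Lemma liftsD F f H h : lifts F f -> lifts H h -> lifts (F + H) (fun x => f x + h x).
Proof.
move=> [sf ->] [sh ->]; split; first exact: smooth_onD.
by rewrite (prolongD oU sf sh Uu).
Qed.

Lemma liftsM F f H h : lifts F f -> lifts H h -> lifts (F * H) (fun x => f x * h x).
Proof.
move=> [sf ->] [sh ->]; split; first exact: smooth_onM.
by rewrite (prolongM oU sf sh Uu).
Qed.

Lemma lifts_congr F f h : (forall x, U x -> f x = h x) -> lifts F f -> lifts F h.
Proof.
move=> fh [sf ->]; split; first exact: smooth_on_congr sf.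
exact: prolong_congr fh Uu.
Qed.

Lemma liftsB F f H h : lifts F f -> lifts H h -> lifts (F - H) (fun x => f x - h x).
Proof.
move=> lF lH; have := liftsD lF (liftsM (lifts_cst (-1)) lH).
rewrite (_ : F + _ = F - H); last first.
  by apply: trunc3P; rewrite !tcoefE /tconst /tcoef0 /tcoef1 /tcoef2 /=; ring.
by apply: lifts_congr => x _; rewrite mulN1r.
Qed.

Lemma lifts_sum (I : Type) (r : seq I) (F : I -> trunc3 R) (f : I -> 'rV[R]_n -> R) :
  (forall i, lifts (F i) (f i)) ->
  lifts (\sum_(i <- r) F i) (fun x => \sum_(i <- r) f i x).
Proof.
move=> lF; elim: r => [|i r IH].
  rewrite big_nil; apply: lifts_congr (lifts_cst 0) => x _.
  by rewrite big_nil.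
rewrite big_cons; apply: lifts_congr (liftsD (lF i) IH) => x _.
by rewrite big_cons.
Qed.

Lemma lifts_curv (C : 'I_n -> 'I_n -> 'I_n -> 'I_n -> trunc3 R)
    (c : 'I_n -> 'I_n -> 'I_n -> 'I_n -> 'rV[R]_n -> R)
    (P Q S : 'rV[trunc3 R]_n) (p q s : 'rV[R]_n -> 'rV[R]_n) :
  (forall a b k d, lifts (C a b k d) (c a b k d)) ->
  (forall k, lifts (P 0 k) (fun x => p x 0 k)) ->
  (forall k, lifts (Q 0 k) (fun x => q x 0 k)) ->
  (forall k, lifts (S 0 k) (fun x => s x 0 k)) ->
  forall k, lifts (curv C P Q S 0 k)
    (fun x => curv (fun a b k d => c a b k d x) (p x) (q x) (s x) 0 k).
Proof.
move=> lC lP lQ lS k; under eq_fun do rewrite mxE.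
rewrite mxE; apply: lifts_sum => a; apply: lifts_sum => b; apply: lifts_sum => l.
by do 3 apply: liftsM => //.
Qed.

Lemma lifts_curv4 (C : 'I_n -> 'I_n -> 'I_n -> 'I_n -> trunc3 R)
    (c : 'I_n -> 'I_n -> 'I_n -> 'I_n -> 'rV[R]_n -> R)
    (GG : 'M[trunc3 R]_n) (g : 'rV[R]_n -> 'M[R]_n)
    (P Q S T : 'rV[trunc3 R]_n) (p q s t : 'rV[R]_n -> 'rV[R]_n) :
  (forall a b k d, lifts (C a b k d) (c a b k d)) ->
  (forall a b, lifts (GG a b) (fun x => g x a b)) ->
  (forall k, lifts (P 0 k) (fun x => p x 0 k)) ->
  (forall k, lifts (Q 0 k) (fun x => q x 0 k)) ->
  (forall k, lifts (S 0 k) (fun x => s x 0 k)) ->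
  (forall k, lifts (T 0 k) (fun x => t x 0 k)) ->
  lifts (curv4 C GG P Q S T)
    (fun x => curv4 (fun a b k d => c a b k d x) (g x) (p x) (q x) (s x) (t x)).
Proof.
move=> lC lG lP lQ lS lT; rewrite /curv4; under eq_fun do rewrite mxE.
rewrite mxE; apply: lifts_sum => a; apply: liftsM; last first.
  by under eq_fun do rewrite mxE; rewrite mxE.
under eq_fun do rewrite mxE; rewrite mxE.
by apply: lifts_sum => b; apply: liftsM => //; exact: lifts_curv.
Qed.

Lemma lifts_curv_curv (C : 'I_n -> 'I_n -> 'I_n -> 'I_n -> trunc3 R)
    (c : 'I_n -> 'I_n -> 'I_n -> 'I_n -> 'rV[R]_n -> R)
    (GG : 'M[trunc3 R]_n) (g : 'rV[R]_n -> 'M[R]_n)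
    (A B P Q S T : 'rV[trunc3 R]_n) (a b p q s t : 'rV[R]_n -> 'rV[R]_n) :
  (forall a b k d, lifts (C a b k d) (c a b k d)) ->
  (forall a b, lifts (GG a b) (fun x => g x a b)) ->
  (forall k, lifts (A 0 k) (fun x => a x 0 k)) ->
  (forall k, lifts (B 0 k) (fun x => b x 0 k)) ->
  (forall k, lifts (P 0 k) (fun x => p x 0 k)) ->
  (forall k, lifts (Q 0 k) (fun x => q x 0 k)) ->
  (forall k, lifts (S 0 k) (fun x => s x 0 k)) ->
  (forall k, lifts (T 0 k) (fun x => t x 0 k)) ->
  lifts (curv_curv C GG A B P Q S T) (fun x => curv_curv (fun a b k d => c a b k d x)
    (g x) (a x) (b x) (p x) (q x) (s x) (t x)).
Proof.
move=> lC lG lA lB lP lQ lS lT.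
have lAP := lifts_curv lC lA lB lP; have lAQ := lifts_curv lC lA lB lQ.
have lAS := lifts_curv lC lA lB lS; have lAT := lifts_curv lC lA lB lT.
apply: (liftsD (liftsD (liftsD _ _) _) _).
- exact: lifts_curv4 lC lG lAP lQ lS lT.
- exact: lifts_curv4 lC lG lP lAQ lS lT.
- exact: lifts_curv4 lC lG lP lQ lAS lT.
exact: lifts_curv4 lC lG lP lQ lS lAT.
Qed.

End Lifts.

Section ProlongDerivatives.
Context {R : realType} {n : nat}.
Variable U : set 'rV[R]_n.
Hypothesis oU : open U.
Let Ubar : set 'rV[R]_(n + n + n) := @xpart R n @^-1` U.

(** The linear forms that have to be differentiated are the coefficients and
    [frob], possibly after multiplication by a constant; all are combinations of
    the three coefficients. *)
Definition coef_combination (L : trunc3 R -> R) (a b c : R) : Prop :=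
  forall F, L F = a * tcoef0 F + b * tcoef1 F + c * tcoef2 F.

Lemma smooth_combination_prolong L a b c f : coef_combination L a b c ->
  smooth_on U f -> smooth_on Ubar (fun u => L (prolong f u)).
Proof.
move=> LE sf; have oUb := open_xpart_preimage oU.
have [s0 s1 s2] := smooth_prolong oU sf.
under eq_fun do rewrite LE.
by apply: smooth_onD => //; [apply: smooth_onD => //|]; exact: smooth_onZ.
Qed.

Lemma partial_combination_prolong i L a b c f u : coef_combination L a b c ->
  smooth_on U f -> Ubar u ->
  partial i (fun u => L (prolong f u)) u =
  L (weight i * prolong (partial (base i) f) u).
Proof.
move=> LE sf Uu; have oUb := open_xpart_preimage oU.
have [s0 s1 s2] := smooth_prolong oU sf.
rewrite LE -(partial_prolong oU i sf Uu).
have z0 := smooth_onZ a oUb s0; have z1 := smooth_onZ b oUb s1.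
have z2 := smooth_onZ c oUb s2.
under eq_fun do rewrite LE.
rewrite (partialD i (smooth_onD oUb z0 z1) z2 Uu) (partialD i z0 z1 Uu).
by rewrite (partialZ i a s0 Uu) (partialZ i b s1 Uu) (partialZ i c s2 Uu).
Qed.

Lemma combination_tcoef0M (c : trunc3 R) :
  coef_combination (fun F => tcoef0 (c * F)) (tcoef0 c) 0 0.
Proof. by move=> F; rewrite !tcoefE; ring. Qed.

Lemma combination_tcoef1M (c : trunc3 R) :
  coef_combination (fun F => tcoef1 (c * F)) (tcoef1 c) (tcoef0 c) 0.
Proof. by move=> F; rewrite !tcoefE; ring. Qed.

Lemma combination_tcoef2M (c : trunc3 R) :
  coef_combination (fun F => tcoef2 (c * F)) (tcoef2 c) (tcoef1 c) (tcoef0 c).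
Proof. by move=> F; rewrite !tcoefE; ring. Qed.

Lemma combination_frobM (c : trunc3 R) :
  coef_combination (fun F => frob (c * F)) (tcoef0 c + tcoef2 c) (tcoef1 c) (tcoef0 c).
Proof. by move=> F; rewrite /frob !tcoefE; ring. Qed.

(** [partial_prolong] for vector fields on T2M whose assembled components are
    multiples of prolonged functions. *)
Lemma assemble_partial i (c : trunc3 R)
    (V : 'rV[R]_(n + n + n) -> 'rV[R]_(n + n + n))
    (f : 'rV[R]_n -> R) (k : 'I_n) u : smooth_on U f ->
  (forall u, Ubar u -> assemble (V u) 0 k = c * prolong f u) -> Ubar u ->
  assemble (\row_j partial i (fun w => V w 0 j) u) 0 k =
  c * (weight i * prolong (partial (base i) f) u).
Proof.
move=> sf Vf Uu; have oUb := open_xpart_preimage oU.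
rewrite assembleE; apply: trunc3P.
- rewrite -(partial_combination_prolong i (combination_tcoef0M c) sf Uu) /tcoef0 [LHS]/=.
  rewrite !mxE; apply: (partial_congr oUb _ _ Uu) => w Uw; rewrite -(Vf w Uw).
  by rewrite assembleE !mxE.
- rewrite -(partial_combination_prolong i (combination_tcoef1M c) sf Uu) /tcoef1 [LHS]/=.
  rewrite !mxE; apply: (partial_congr oUb _ _ Uu) => w Uw; rewrite -(Vf w Uw).
  by rewrite assembleE !mxE.
- rewrite -(partial_combination_prolong i (combination_tcoef2M c) sf Uu) /tcoef2 [LHS]/=.
  rewrite !mxE; apply: (partial_congr oUb _ _ Uu) => w Uw; rewrite -(Vf w Uw).
  by rewrite assembleE !mxE.
Qed.

End ProlongDerivatives.

(** * The prolonged metric and its curvature *)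

Section FrobeniusForm.
Context {R : realType} {n : nat}.
Implicit Types (i j : 'I_(n + n + n)) (k l : 'I_n).

(** The three blocks over a coordinate give a_0 + a_2, a_1 and a_0. *)
Lemma frob_nondegenerate (a : 'I_n -> trunc3 R) :
  (forall i, frob (weight i * a (base i)) = 0) -> forall k, a k = 0.
Proof.
move=> h k.
have := h (lshift n (lshift n k)); have := h (lshift n (rshift n k)).
have := h (rshift (n + n) k).
rewrite /weight /base !(unsplitK (inl _)) !(unsplitK (inr _)).
rewrite /frob !tcoefE /tcoef0 /tcoef1 /tcoef2 /= !(mul0r, mul1r, add0r, addr0) => z0 z1 z2.
apply: trunc3P; rewrite /tcoef0 /tcoef1 /tcoef2 //=.
by move: z2; rewrite z0 add0r.
Qed.

Lemma assemble_linear c (p q : 'rV[R]_(n + n + n)) k :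
  assemble (c *: p + q) 0 k = tconst c * assemble p 0 k + assemble q 0 k.
Proof.
rewrite !assembleE !linearP !mxE.
by apply: trunc3P; rewrite !tcoefE /tcoef0 /tcoef1 /tcoef2 /=; ring.
Qed.

Lemma assemble_sum (I : Type) (r : seq I) (c : I -> R)
    (p : I -> 'rV[R]_(n + n + n)) k :
  assemble (\sum_(i <- r) c i *: p i) 0 k =
  \sum_(i <- r) tconst (c i) * assemble (p i) 0 k.
Proof.
elim: r => [|i r IH]; last by rewrite !big_cons assemble_linear IH.
by rewrite !big_nil assembleE !linear0 !mxE.
Qed.

End FrobeniusForm.

Section ProlongedMetric.
Context {R : realType} {n : nat}.
Variables (U : set 'rV[R]_n) (G : 'rV[R]_n -> 'M[R]_n).
Variable Gbar : 'rV[R]_(n + n + n) -> 'M[R]_(n + n + n).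
Let Ubar : set 'rV[R]_(n + n + n) := @xpart R n @^-1` U.
Hypothesis oU : open U.
Hypothesis sG : forall a b, smooth_on U (fun x => G x a b).
Hypothesis uG : forall x, U x -> G x \in unitmx.
Hypothesis GbarE : forall u i j, Ubar u ->
  Gbar u i j = frob (weight i * weight j * prolong (fun x => G x (base i) (base j)) u).

Let oUb : open Ubar. Proof. exact: open_xpart_preimage. Qed.

Let GA u : 'M[trunc3 R]_n := \matrix_(a, b) prolong (fun x => G x a b) u.
Let riemA u a b k d : trunc3 R := prolong (riemann G a b k d) u.

Lemma smooth_Gbar i j : smooth_on Ubar (fun u => Gbar u i j).
Proof.
apply: (smooth_on_congr oUb _ (smooth_combination_prolong oU
  (combination_frobM (weight i * weight j)) (sG (base i) (base j)))).
by move=> u Uu; rewrite GbarE.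
Qed.

Lemma Gbar_row u i (w : 'rV[R]_(n + n + n)) : Ubar u ->
  \sum_j Gbar u i j * w 0 j =
  frob (weight i * \sum_k GA u (base i) k * assemble w 0 k).
Proof.
move=> Uu; transitivity (frob (weight i * \sum_k assemble w 0 k * GA u (base i) k)).
  rewrite -sum_blocks mulr_sumr frob_sum; apply: eq_bigr => j _.
  rewrite mulrCA frob_cst mulrC GbarE// mxE; congr (_ * frob _).
  by rewrite mulrA.
by under eq_bigr do rewrite mulrC.
Qed.

(** By nondegeneracy of [frob], G W = 0 over truncated polynomials, and the
    prolongation of the inverse of G is an inverse of the prolongation of G. *)
Lemma frob_GA_inj u (W : 'I_n -> trunc3 R) : Ubar u ->
  (forall i, frob (weight i * \sum_k GA u (base i) k * W k) = 0) ->
  forall k, W k = 0.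
Proof.
move=> Uu h.
have {}h := frob_nondegenerate (a := fun b => \sum_k GA u b k * W k) h.
move=> m.
(* The prolonged inverse of G, contracted with the system G W = 0. *)
pose IA (a b : 'I_n) := prolong (fun x => invmx (G x) a b) u.
have invE b : \sum_a IA m a * GA u a b = (m == b)%:R.
  have sI a c : smooth_on U (fun x => invmx (G x) a c) by exact: smooth_on_invmx.
  have : lifts U u (\sum_a IA m a * GA u a b)
      (fun x => \sum_a invmx (G x) m a * G x a b).
    apply: (lifts_sum oU Uu) => a.
    by apply: (liftsM oU Uu) => //; rewrite mxE.
  move=> [_ ->]; rewrite (prolong_congr (U := U) (h := fun _ => (m == b)%:R) oU) //.
    by rewrite prolong_cst; case: eqP.
  move=> x Ux; have := mulVmx (uG Ux) => /(congr1 (fun M : 'M[R]_n => M m b)).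
  by rewrite !mxE.
have : \sum_a IA m a * (\sum_k GA u a k * W k) = 0.
  by rewrite big1// => a _; rewrite h mulr0.
under eq_bigr do rewrite mulr_sumr.
rewrite exchange_big /=.
under eq_bigr do under eq_bigr do rewrite mulrA.
under eq_bigr do rewrite -mulr_suml invE.
rewrite (bigD1 m)//= eqxx mul1r big1 ?addr0// => b /negPf bm.
by rewrite eq_sym bm mul0r.
Qed.

Lemma Gbar_unit u : Ubar u -> Gbar u \in unitmx.
Proof.
move=> Uu; rewrite -unitmx_tr -row_free_unit; apply: inj_row_free => w wG.
apply: assemble_inj; apply/rowP => k.
have -> : assemble (0 : 'rV[R]_(n + n + n)) 0 k = 0.
  by rewrite assembleE !linear0 !mxE.
move: k; apply: (frob_GA_inj (W := fun k => assemble w 0 k) Uu) => i.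
rewrite -Gbar_row//; have := congr1 (fun M : 'rV[R]_(n + n + n) => M 0 i) wG.
rewrite [RHS]mxE mxE => /(etrans _); apply.
by apply: eq_bigr => j _; rewrite mxE mulrC.
Qed.

Lemma christoffel_low_bar l i j u : Ubar u ->
  christoffel_low Gbar l i j u = frob (weight l * (weight i * weight j *
    prolong (christoffel_low G (base l) (base i) (base j)) u)).
Proof.
move=> Uu.
have pE a b c : partial a (fun w => Gbar w b c) u = frob (weight b * weight c *
    (weight a * prolong (partial (base a) (fun x => G x (base b) (base c))) u)).
  rewrite -(partial_combination_prolong oU a (combination_frobM _) (sG _ _) Uu).
  by apply: (partial_congr oUb _ _ Uu) => w Uw; rewrite GbarE.
rewrite /christoffel_low !pE.
have sp a b c : smooth_on U (partial a (fun x => G x b c)).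
  exact: smooth_on_partial.
have [_ <-] := liftsB oU Uu (liftsD oU Uu
   (lifts_prolong u (sp (base i) (base j) (base l)))
   (lifts_prolong u (sp (base j) (base i) (base l))))
   (lifts_prolong u (sp (base l) (base i) (base j))).
move: (prolong _ _) (prolong _ _) (prolong _ _) (weight i) (weight j) (weight l).
by move=> *; rewrite -frobD -frobB; congr frob; ring.
Qed.

(** Both sides solve the same linear system, whose right-hand side is given by the
    symbols of the first kind, and [frob_GA_inj] says that it has one solution. *)
Lemma christoffel_bar i j k u : Ubar u ->
  assemble (\row_l christoffel Gbar l i j u) 0 k =
  weight i * weight j * prolong (christoffel G k (base i) (base j)) u.
Proof.
move=> Uu; apply/eqP; rewrite -subr_eq0; apply/eqP; move: k.
pose W k := assemble (\row_l christoffel Gbar l i j u) 0 k -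
  weight i * weight j * prolong (christoffel G k (base i) (base j)) u.
apply: (frob_GA_inj (W := W) Uu) => l.
have low n' (H : 'rV[R]_n' -> 'M[R]_n') x a b c : H x \in unitmx ->
    \sum_m H x a m * christoffel H m b c x = 2^-1 * christoffel_low H a b c x.
  move=> uH; pose v := \col_m christoffel_low H m b c x.
  transitivity ((H x *m (2^-1 *: (invmx (H x) *m v))) a 0).
    rewrite mxE; apply: eq_bigr => m _; rewrite !mxE; congr (_ * (_ * _)).
    by apply: eq_bigr => q _; rewrite mxE.
  by rewrite -scalemxAr mulKVmx// !mxE.
have e1 : frob (weight l * \sum_k GA u (base l) k *
    assemble (\row_l christoffel Gbar l i j u) 0 k) =
  2^-1 * christoffel_low Gbar l i j u.
  rewrite -Gbar_row// -low; last exact: Gbar_unit.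
  by apply: eq_bigr => m _; rewrite mxE.
have sg a b c : smooth_on U (christoffel G a b c) by exact: smooth_christoffel.
have e2 : \sum_k GA u (base l) k * prolong (christoffel G k (base i) (base j)) u =
    tconst 2^-1 * prolong (christoffel_low G (base l) (base i) (base j)) u.
  have l1 : lifts U u (\sum_k GA u (base l) k *
        prolong (christoffel G k (base i) (base j)) u)
      (fun x => \sum_k G x (base l) k * christoffel G k (base i) (base j) x).
    apply: (lifts_sum oU Uu) => m; apply: (liftsM oU Uu); last exact: lifts_prolong.
    by rewrite mxE; exact: lifts_prolong.
  have l2 : lifts U u
      (tconst 2^-1 * prolong (christoffel_low G (base l) (base i) (base j)) u)
      (fun x => 2^-1 * christoffel_low G (base l) (base i) (base j) x).
    apply: (liftsM oU Uu); first exact: lifts_cst.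
    by apply: lifts_prolong; exact: smooth_christoffel_low.
  rewrite l1.2 l2.2; apply: (prolong_congr oU _ Uu) => x Ux.
  by rewrite low//; exact: uG.
rewrite /W; under eq_bigr do rewrite mulrBr.
rewrite sumrB mulrBr frobB e1 christoffel_low_bar//.
under eq_bigr do rewrite mulrCA.
rewrite -mulr_sumr e2 -frob_cst -frobB.
rewrite [X in frob X](_ : _ = 0) ?[frob 0]addr0//.
ring.
Qed.

(** Derivatives and products of Christoffel symbols are prolonged one by one; in
    the quadratic terms, contraction over the coordinates of T2M becomes
    contraction over those of M by [sum_blocks]. *)
Lemma riemann_bar i j m d u : Ubar u ->
  assemble (\row_l riemann Gbar i j m l u) 0 d =
  weight i * weight j * weight m *
  prolong (riemann G (base i) (base j) (base m) d) u.
Proof.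
move=> Uu.
pose gam a b w : 'rV[R]_(n + n + n) := \row_l christoffel Gbar l a b w.
pose dgam a b c : 'rV[R]_(n + n + n) := \row_l partial a (fun w => gam b c w 0 l) u.
have sg a b c : smooth_on U (christoffel G a b c) by exact: smooth_christoffel.
have dgamE a b c k : assemble (dgam a b c) 0 k = weight b * weight c *
    (weight a * prolong (partial (base a) (christoffel G k (base b) (base c))) u).
  apply: (assemble_partial oU _ (sg _ _ _)) => // w Uw.
  exact: christoffel_bar.
have quadE a b c k :
    assemble (\sum_l gam b c u 0 l *: gam a l u) 0 k =
    weight a * weight b * weight c * \sum_l prolong (christoffel G k (base a) l) u
      * prolong (christoffel G l (base b) (base c)) u.
  rewrite assemble_sum.
  transitivity (\sum_l tconst (gam b c u 0 l) * (weight l *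
      (weight a * prolong (christoffel G k (base a) (base l)) u))).
    apply: eq_bigr => l _; rewrite (christoffel_bar _ _ _ Uu) -mulrA.
    by rewrite [weight a * (weight l * _)]mulrCA.
  rewrite (sum_blocks _ (fun l => weight a * prolong (christoffel G k (base a) l) u)).
  rewrite mulr_sumr; apply: eq_bigr => l _; rewrite (christoffel_bar _ _ _ Uu).
  by move: (prolong _ _) (prolong _ _) => *; ring.
have -> : \row_l riemann Gbar i j m l u = (-1) *: (\sum_l gam i m u 0 l *: gam j l u)
    + ((-1) *: dgam j i m + (1 *: dgam i j m + \sum_l gam j m u 0 l *: gam i l u)).
  apply/rowP => l; rewrite !mxE !summxE /riemann sumrB.
  have e a b : \sum_p christoffel Gbar l a p u * christoffel Gbar p b m u =
      \sum_p (gam b m u 0 p *: gam a p u) 0 l.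
    by apply: eq_bigr => p _; rewrite !mxE mulrC.
  rewrite !e; have pe a b : partial a (christoffel Gbar l b m) u =
      partial a (fun w => gam b m w 0 l) u.
    by apply: (partial_congr oUb _ _ Uu) => w _; rewrite mxE.
  rewrite !pe; move: (partial _ _ _) (partial _ _ _) (\sum_p _) (\sum_p _) => *.
  by ring.
clearbody gam dgam.
rewrite (assemble_linear (-1) (\sum_l _)) (assemble_linear (-1) (dgam j i m)).
rewrite (assemble_linear 1 (dgam i j m)) (quadE i j m) (quadE j i m).
rewrite (dgamE i j m) (dgamE j i m).
have -> : prolong (riemann G (base i) (base j) (base m) d) u =
    prolong (partial (base i) (christoffel G d (base j) (base m))) u
    - prolong (partial (base j) (christoffel G d (base i) (base m))) u
    + (\sum_l prolong (christoffel G d (base i) l) u *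
         prolong (christoffel G l (base j) (base m)) u
       - \sum_l prolong (christoffel G d (base j) l) u *
         prolong (christoffel G l (base i) (base m)) u).
  have sp a b c e : smooth_on U (partial a (christoffel G b c e)).
    exact: smooth_on_partial.
  rewrite -sumrB.
  have lg a b c := lifts_prolong u (sg a b c).
  have l1 := lifts_sum oU Uu (index_enum 'I_n) (fun l => liftsB oU Uu
    (liftsM oU Uu (lg d (base i) l) (lg l (base j) (base m)))
    (liftsM oU Uu (lg d (base j) l) (lg l (base i) (base m)))).
  have l2 := liftsD oU Uu (liftsB oU Uu
    (lifts_prolong u (sp (base i) d (base j) (base m)))
    (lifts_prolong u (sp (base j) d (base i) (base m)))) l1.
  by rewrite l2.2.
have -> : tconst (-1) = -1 :> trunc3 R.
  by apply: trunc3P; rewrite !tcoefE /tconst /tcoef0 /tcoef1 /tcoef2 /= ?oppr0.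
have -> : tconst 1 = 1 :> trunc3 R by [].
have collect (wi wj wm A B C D : trunc3 R) :
    -1 * (wj * wi * wm * D) + (-1 * (wi * wm * (wj * B)) +
      (1 * (wj * wm * (wi * A)) + wi * wj * wm * C)) =
    wi * wj * wm * (A - B + (C - D)) by ring.
exact: collect.
Qed.

Lemma curv_bar (p q r : 'rV[R]_(n + n + n)) u : Ubar u ->
  assemble (curv (fun a b k d => riemann Gbar a b k d u) p q r) =
  curv (riemA u) (assemble p) (assemble q) (assemble r).
Proof.
move=> Uu; apply/rowP => d.
have -> : curv (fun a b k d => riemann Gbar a b k d u) p q r =
    \sum_a 1 *: \sum_b 1 *: \sum_k (p 0 a * q 0 b * r 0 k) *:
      (\row_l riemann Gbar a b k l u).
  apply/rowP => l; rewrite mxE summxE; apply: eq_bigr => a _.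
  rewrite scale1r summxE; apply: eq_bigr => b _; rewrite scale1r summxE.
  by apply: eq_bigr => k _; rewrite !mxE.
rewrite assemble_sum [RHS]mxE.
under eq_bigr do rewrite assemble_sum mulr_sumr.
under eq_bigr do under eq_bigr do rewrite assemble_sum mulr_sumr mulr_sumr.
transitivity (\sum_a tconst (p 0 a) * (weight a * \sum_b tconst (q 0 b) * (weight b *
    \sum_k tconst (r 0 k) * (weight k * riemA u (base a) (base b) (base k) d)))).
  apply: eq_bigr => a _; rewrite !mulr_sumr; apply: eq_bigr => b _.
  rewrite !mulr_sumr; apply: eq_bigr => k _.
  rewrite (riemann_bar _ _ _ _ Uu) (_ : tconst 1 = 1) // !mul1r.
  have -> : tconst (p 0 a * q 0 b * r 0 k) =
      tconst (p 0 a) * tconst (q 0 b) * tconst (r 0 k).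
    by apply: trunc3P; rewrite !tcoefE /tconst /tcoef0 /tcoef1 /tcoef2 /=; ring.
  rewrite /riemA; move: (prolong _ _) (tconst _) (tconst _) (tconst _) => *; ring.
rewrite (sum_blocks p (fun a => \sum_b tconst (q 0 b) * (weight b *
    \sum_k tconst (r 0 k) * (weight k * riemA u a (base b) (base k) d)))).
apply: eq_bigr => a _.
rewrite (sum_blocks q (fun b =>
    \sum_k tconst (r 0 k) * (weight k * riemA u a b (base k) d))) mulr_sumr.
apply: eq_bigr => b _.
rewrite (sum_blocks r (fun k => riemA u a b k d)) !mulr_sumr.
by apply: eq_bigr => k _; rewrite !mulrA.
Qed.

Lemma Gbar_form (p q : 'rV[R]_(n + n + n)) u : Ubar u ->
  (p *m Gbar u *m q^T) 0 0 = frob ((assemble p *m GA u *m (assemble q)^T) 0 0).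
Proof.
move=> Uu; rewrite -!mulmxA mxE.
transitivity (frob (\sum_i tconst (p 0 i) * (weight i *
    \sum_k GA u (base i) k * assemble q 0 k))).
  rewrite frob_sum; apply: eq_bigr => i _; rewrite frob_cst -Gbar_row//.
  by rewrite mxE; congr (_ * _); apply: eq_bigr => j _; rewrite mxE.
rewrite (sum_blocks p (fun a => \sum_k GA u a k * assemble q 0 k)).
apply: congr1; rewrite [RHS]mxE; apply: eq_bigr => a _.
apply: (congr1 (GRing.mul _)); rewrite [RHS]mxE; apply: eq_bigr => k _.
by rewrite [X in _ = _ * X]mxE.
Qed.

Lemma curv_curv_bar (p q r s v w : 'rV[R]_(n + n + n)) u : Ubar u ->
  curv_curv (fun a b k d => riemann Gbar a b k d u) (Gbar u) p q r s v w =
  frob (curv_curv (riemA u) (GA u) (assemble p) (assemble q) (assemble r)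
    (assemble s) (assemble v) (assemble w)).
Proof.
move=> Uu; rewrite /curv_curv /curv4 !(Gbar_form _ _ Uu) !(curv_bar _ _ _ Uu).
by rewrite !frobD.
Qed.

Lemma prolonged_semi_symmetricP :
  (forall u, Ubar u -> forall p q r s v w,
     curv_curv (fun a b k d => riemann Gbar a b k d u) (Gbar u) p q r s v w = 0) <->
  (forall x, U x -> forall p q r s v w,
     curv_curv (fun a b k d => riemann G a b k d x) (G x) p q r s v w = 0).
Proof.
split=> [h x Ux p q r s v w|h u Uu p q r s v w]; last first.
  rewrite (curv_curv_bar _ _ _ _ _ _ Uu) curv_curv_eq0 /frob ?addr0 //.
  move=> i1 i2 i3 i4 i5 i6.
  have ld i k : lifts U u ((delta_mx 0 i : 'rV[trunc3 R]_n) 0 k)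
      (fun _ => (delta_mx 0 i : 'rV[R]_n) 0 k).
    rewrite (_ : delta_mx _ _ _ _ = tconst ((delta_mx 0 i : 'rV[R]_n) 0 k)).
      exact: lifts_cst.
    by rewrite !mxE; case: (_ && _).
  have lR a b k d : lifts U u (riemA u a b k d) (riemann G a b k d).
    by apply: lifts_prolong; exact: smooth_riemann.
  have lG a b : lifts U u (GA u a b) (fun x => G x a b).
    by rewrite mxE; exact: lifts_prolong.
  have [_ ->] := lifts_curv_curv oU Uu lR lG
    (ld i1) (ld i2) (ld i3) (ld i4) (ld i5) (ld i6).
  rewrite (prolong_congr (h := fun _ => 0) oU _ Uu) ?prolong_cst// => x Ux.
  exact: h.
(* With the last vector in the block of weight e^2, [frob] extracts the constant
   coefficient, that is, the value at the base point. *)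
pose base_vec (y : 'rV[R]_n) : 'rV[R]_(n + n + n) := row_mx (row_mx y 0) 0.
pose z_vec (y : 'rV[R]_n) : 'rV[R]_(n + n + n) := row_mx 0 y.
pose u := base_vec x.
have xu : xpart u = x by rewrite /xpart !row_mxKl.
have Uu : Ubar u by rewrite /Ubar /preimage /= xu.
have bE y k : assemble (base_vec y) 0 k = tconst (y 0 k).
  by rewrite assembleE /xpart /ypart /zpart /base_vec !(row_mxKl, row_mxKr) !mxE.
pose e2 : trunc3 R := ((0, 0), 1).
have zE y : assemble (z_vec y) = e2 *: assemble (base_vec y).
  apply/rowP => k; rewrite [RHS]mxE bE.
  rewrite assembleE /xpart /ypart /zpart /z_vec !(row_mxKl, row_mxKr).
  rewrite linear0 !mxE; apply: trunc3P; rewrite ?tcoefE /tconst /tcoef0 /tcoef1 /tcoef2 /=; ring.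
have := h u Uu (base_vec p) (base_vec q) (base_vec r) (base_vec s)
  (base_vec v) (z_vec w).
rewrite (curv_curv_bar _ _ _ _ _ _ Uu) zE curv_curv_scale6.
have -> (F : trunc3 R) : frob (e2 * F) = tcoef0 F.
  by rewrite /frob !tcoefE /e2 /tcoef0 /tcoef1 /tcoef2 /=; ring.
rewrite (rmorph_curv_curv (@tcoef0 R)).
have mE y : map_mx (@tcoef0 R) (assemble (base_vec y)) = y.
  by apply/rowP => k; rewrite [LHS]mxE bE.
have gE : map_mx (@tcoef0 R) (GA u) = G x.
  by apply/matrixP => a b; rewrite [LHS]mxE [X in tcoef0 X]mxE /tcoef0 /= xu.
have -> : (fun a b k d => tcoef0 (riemA u a b k d)) =
    (fun a b k d => riemann G a b k d x).
  by do 4 apply/funext => ?; rewrite -[in RHS]xu.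
by rewrite !mE gE.
Qed.

End ProlongedMetric.

(** * Curves with a prescribed second-order jet *)

Section Oscillation.
Context {R : realType}.
Implicit Types (a b e t : R).

Lemma is_derive_trig a b e t :
  is_derive t (1 : R) (fun t => a * sin (t / e) + b * cos (t / e))
    (- b / e * sin (t / e) + a / e * cos (t / e)).
Proof.
have dl : is_derive t (1 : R) (fun t : R => t / e) e^-1.
  apply: is_derive_eq; by rewrite /GRing.scale /=; ring.
have ds : is_derive t (1 : R) (fun t => sin (t / e)) (cos (t / e) * e^-1).
  apply: (@is_derive1_comp R sin (fun t => t / e)).
have dc : is_derive t (1 : R) (fun t => cos (t / e)) (- sin (t / e) * e^-1).
  apply: (@is_derive1_comp R cos (fun t => t / e)).
apply: is_derive_eq; rewrite /GRing.scale /=; ring.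
Qed.

(** Unlike the sine alone, this family is stable under differentiation. *)
Lemma smooth_trig a b e :
  smooth_on setT (fun t : R => a * sin (t / e) + b * cos (t / e)).
Proof.
move=> k; elim: k a b => [|k IH] a b.
  move=> t _; apply: differentiable_continuous; apply/derivable1_diffP.
  by have [] := is_derive_trig a b e t.
split=> [t _|v].
  by apply/derivable1_diffP; have [] := is_derive_trig a b e t.
rewrite (_ : 'D_v _ = fun t =>
    (v * (- b / e)) * sin (t / e) + (v * (a / e)) * cos (t / e)).
  exact: IH.
apply/funext => t; have [dt dtE] := is_derive_trig a b e t.
have /derivable1_diffP df := dt.
rewrite (deriveE _ df) -[v in 'd _ _ v]mulr1 [LHS]linearZ -(deriveE _ df) dtE.
transitivity (v * (- b / e * sin (t / e) + a / e * cos (t / e))) => //; ring.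
Qed.

End Oscillation.

Section OscillatingCurve.
Context {R : realType} {n : nat}.
Variables (x y z : 'rV[R]_n) (e : R).
Hypothesis e0 : e != 0.

Let s (t : R) := e * sin (t / e).

(** The function t |-> e sin (t / e) is bounded by e and has the same second-order
    jet at 0 as the identity.  Substituting it for t in x + t y + t^2 z keeps the
    jet at 0 and confines the curve to a neighbourhood of x. *)
Definition osc_curve (t : R) : 'rV[R]_n := x + s t *: y + (s t) ^+ 2 *: z.

Let osc_curveE t j : osc_curve t 0 j = x 0 j + s t * y 0 j + s t * s t * z 0 j.
Proof. by rewrite /osc_curve !mxE expr2. Qed.

Lemma smooth_osc_curve : smooth_on setT osc_curve.
Proof.
have ss : smooth_on setT s.
  apply: (smooth_on_congr openT _ (smooth_trig e 0 e)) => t _.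
  by rewrite mul0r addr0.
move=> k; apply/(Ck_on_mxP _ _ openT) => i j; rewrite ord1; move: k.
rewrite -/(smooth_on setT (fun t => osc_curve t 0 j)).
apply: (smooth_on_congr openT
  (f := fun t => x 0 j + s t * y 0 j + s t * s t * z 0 j)).
  by move=> t _; rewrite osc_curveE.
have oT : open [set: R] := openT.
have sc (c : R) : smooth_on [set: R] (fun _ => c) by exact: smooth_on_cst.
apply: (smooth_onD oT); last exact: (smooth_onM oT (smooth_onM oT ss ss)).
by apply: (smooth_onD oT) => //; exact: (smooth_onM oT).
Qed.

Lemma osc_curve0 : osc_curve 0 = x.
Proof. by rewrite /osc_curve /s mul0r sin0 mulr0 expr0n /= !scale0r !addr0. Qed.

Let is_derive_s t : is_derive t (1 : R) s (cos (t / e)).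
Proof.
rewrite (_ : s = fun t => e * sin (t / e) + 0 * cos (t / e)).
  apply: (is_derive_eq (is_derive_trig e 0 e t)).
  by rewrite oppr0 !mul0r add0r mulfV// mul1r.
by apply/funext => r; rewrite mul0r addr0.
Qed.

Lemma derive1_rV (f : R -> 'rV[R]_n) (df : R -> 'I_n -> R) :
  (forall t j, is_derive t (1 : R) (fun t => f t 0 j) (df t j)) ->
  derive1 f = fun t => \row_j df t j.
Proof.
move=> fdf; apply/funext => t; rewrite derive1E derive_mx; last first.
  by apply/derivable_mxP => i j; rewrite ord1; have [] := fdf t j.
by apply/rowP => j; rewrite !mxE; have [_ ->] := fdf t j.
Qed.

Let d1 t j := cos (t / e) * y 0 j + 2 * (s t * cos (t / e)) * z 0 j.

Lemma derive1_osc_curve : derive1 osc_curve = fun t => \row_j d1 t j.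
Proof.
apply: derive1_rV => t j; have ds := is_derive_s t.
under eq_fun do rewrite osc_curveE.
by apply: is_derive_eq; rewrite /d1 /GRing.scale /=; ring.
Qed.

Lemma derive1_osc_curve0 : derive1 osc_curve 0 = y.
Proof.
rewrite derive1_osc_curve; apply/rowP => j; rewrite mxE /d1 /s mul0r cos0 sin0.
by ring.
Qed.

Lemma derive2_osc_curve0 : derive1n 2 osc_curve 0 = 2 *: z.
Proof.
rewrite derive1nS derive1n1 derive1_osc_curve.
pose d2 t j := - sin (t / e) / e * y 0 j +
  2 * (cos (t / e) * cos (t / e) - s t * (sin (t / e) / e)) * z 0 j.
have -> : derive1 (fun t => \row_j d1 t j) = fun t => \row_j d2 t j.
  apply: derive1_rV => t j; have ds := is_derive_s t.
  have dc : is_derive t (1 : R) (fun t => cos (t / e)) (- sin (t / e) / e).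
    rewrite (_ : (fun t => cos (t / e)) =
        fun t => 0 * sin (t / e) + 1 * cos (t / e)).
      by apply: (is_derive_eq (is_derive_trig 0 1 e t)); ring.
    by apply/funext => r; ring.
  under eq_fun do rewrite mxE /d1.
  by apply: is_derive_eq; rewrite /d2 /GRing.scale /=; ring.
apply/rowP => j; rewrite !mxE /d2 /s mul0r cos0 sin0; ring.
Qed.

End OscillatingCurve.

Lemma osc_curve_near (R : realType) n (U : set 'rV[R]_n) (x y z : 'rV[R]_n) :
  open U -> U x -> exists2 e : R, 0 < e & forall t, U (osc_curve x y z e t).
Proof.
move=> oU Ux.
pose h (r : R) : 'rV[R]_n := x + r *: y + r ^+ 2 *: z.
have ch : {for 0, continuous h}.
  have -> : h = (fun r => x + r *: y + r *: (r *: z)).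
    by apply/funext => r; rewrite /h expr2 scalerA.
  apply: cvgD; first by apply: cvgD; [exact: cvg_cst|exact: scalel_continuous].
  by apply: cvgZ; [exact: cvg_id|exact: scalel_continuous].
have h0 : h 0 = x by rewrite /h expr0n /= !scale0r !addr0.
have : nbhs (h 0) U by rewrite h0; exact: open_nbhs_nbhs.
move=> /ch /nbhs_ballP [d /= d0 dU]; exists (d / 2); first exact: divr_gt0.
move=> t; apply: dU; rewrite -ball_normE /= sub0r normrN normrM.
rewrite (le_lt_trans (ler_wpM2l _ (sin_max _)))// mulr1 ger0_norm ?divr_ge0// 1?ltW//.
by rewrite ltr_pdivrMr// ltr_pMr// ltr1n.
Qed.

(** * Charts of the second-order tangent bundle *)

Section SecondOrderCharts.
Context {R : realType} {n : nat}.
Variable M : atlas R n.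
Hypothesis hM : is_manifold M.

Lemma img_open (i : chart M) : open (img i).
Proof. by have := overlap_open hM (i := i) (j := i); rewrite setIid. Qed.

Lemma transition_coord (i j : chart M) p : dom i p -> dom j p ->
  transition i j (Defs.coord i p) = Defs.coord j p.
Proof.
move=> ip jp; apply: xget_subset1; first by exists p.
move=> y y' [q [iq _ qp <-]] [q' [iq' _ qp' <-]]; congr (Defs.coord j _).
by apply: (coord_inj hM (i := i)); rewrite ?inE// qp qp'.
Qed.

Lemma smooth_curve_chart (i : chart M) (f : R -> 'rV[R]_n) (F : R -> Defs.point M) :
  smooth_on setT f -> (forall t, dom i (F t) /\ Defs.coord i (F t) = f t) ->
  smooth_curve F.
Proof.
move=> sf FP j.
have domE : F @^-1` dom j = f @^-1` (Defs.coord i @` (dom i `&` dom j)).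
  apply/seteqP; split=> t /=; have [iF Ff] := FP t.
    by move=> jF; exists (F t).
  move=> [q [iq jq] qf]; suff -> : F t = q by [].
  by apply: (coord_inj hM (i := i)); rewrite ?inE// qf.
have oA : open (F @^-1` dom j).
  rewrite domE; apply: open_comp; last exact: overlap_open.
  by move=> t _; exact: (sf 0).
split=> // k.
have : Ck_on (F @^-1` dom j) k (transition i j \o f).
  apply/(Ck_on_mxP _ _ oA) => a b.
  apply: (Ck_on_comp (U := Defs.coord i @` (dom i `&` dom j))
    (h := fun x => transition i j x a b) oA).
  - by move=> t; rewrite domE.
  - exact: Ck_on_sub (subsetT _) (sf k).
  - have sT := transition_smooth hM i j.
    have oij := overlap_open hM (i := i) (j := j).
    by have := (Ck_on_mxP k (transition i j) oij).1 (sT k); apply.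
apply: Ck_on_congr => // t /= jF; have [iF <-] := FP t.
exact: transition_coord.
Qed.

(** A 2-jet is determined by its coordinates in one chart, and all coordinates
    occur because the curve [osc_curve] lifts to a smooth curve of M. *)
Lemma img_T2 (i : chart M) : @img R (n + n + n) (T2 M) i = @xpart R n @^-1` img i.
Proof.
apply/seteqP; split=> u /=.
  move=> [J [F JF iF] <-]; rewrite -[@Defs.coord _ _ (T2 M) i J]/(jet_coord i J).
  have [F0 sF0 JE] := svalP J.
  have : [set v | exists2 F', sval J F' & curve_coord i F' = v] (jet_coord i J).
    by apply: (xgetI _ (x := curve_coord i F)); exists F.
  move=> [F' JF' <-]; exists (F' 0).
    move: JF JF' iF; rewrite JE => -[_ [FF _]] [_ [FF' _]].
    by rewrite -FF FF'.
  by rewrite /curve_coord /xpart !row_mxKl.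
move=> [p ip px].
have Ux : img i (xpart u) by exists p.
have [e e0 eU] := osc_curve_near (ypart u) (zpart u) (img_open (i := i)) Ux.
have e_neq0 : e != 0 by rewrite gt_eqF.
pose f := osc_curve (xpart u) (ypart u) (zpart u) e.
have ex t : exists q, dom i q /\ Defs.coord i q = f t.
  by have [q iq qf] := eU t; exists q.
pose F t := sval (cid (ex t)).
have FP t : dom i (F t) /\ Defs.coord i (F t) = f t := svalP (cid (ex t)).
have sF : smooth_curve F by apply: smooth_curve_chart FP; exact: smooth_osc_curve.
have Fu : curve_coord i F = u.
  have fE : Defs.coord i \o F = f by apply/funext => t; have [] := FP t.
  rewrite /curve_coord fE /f osc_curve0 derive1_osc_curve0// derive2_osc_curve0//.
  by rewrite scalerA mulVf ?pnatr_eq0// scale1r /xpart /ypart /zpart !hsubmxK.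
pose J : jet M := exist _ [set F' | smooth_curve F' /\ same_jet F F']
  (ex_intro2 _ _ F sF erefl).
have JF : sval J F by [].
exists J; first by exists F => //; have [] := FP 0.
apply: xget_subset1; first by exists F.
have uE v : [set v | exists2 F', sval J F' & curve_coord i F' = v] v -> v = u.
  move=> [F' [_ [_ jF']] <-]; rewrite -Fu jF'//.
  by have [] := FP 0.
by move=> v v' /uE -> /uE ->.
Qed.

Lemma T2_metricE (g : matrices M) (i : chart M) u a b :
  (forall a b, smooth_on (img i) (fun x => g i x a b)) -> img i (xpart u) ->
  T2_metric g i u a b = frob (weight a * weight b *
    prolong (fun x => g i x (base a) (base b)) u).
Proof.
move=> sg Uu; rewrite (prolongE (img_open (i := i)) (sg _ _) Uu).
rewrite /T2_metric mxE /lift2 /lift0 /weight /base.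
have zE p q (k : 'I_p) (l : 'I_q) : (0 : 'M[R]_(p, q)) k l = 0 by rewrite mxE.
case: (split_ordP a) => [a' ->|c ->]; [case: (split_ordP a') => [c ->|c ->]|];
(case: (split_ordP b) => [b' ->|d ->]; [case: (split_ordP b') => [d ->|d ->]|]);
rewrite ?(block_mxEul, block_mxEur, block_mxEdl, block_mxEdr, col_mxEu, col_mxEd,
  row_mxEl, row_mxEr) /frob ?tcoefE /tcoef0 /tcoef1 /tcoef2 /= ?zE
  ?(mul0r, mulr0, mul1r, mulr1, add0r, addr0) //.
- by rewrite [X in X + _]mxE addrC.
- by rewrite [LHS]mxE.
- by rewrite [LHS]mxE.
Qed.

Lemma semi_symmetric_on_T2 (g : matrices M) (i : chart M) :
  is_pseudo_riemannian g ->
  semi_symmetric_on (@xpart R n @^-1` img i) (T2_metric g i) <->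
  semi_symmetric_on (img i) (g i).
Proof.
move=> hg; have oU := img_open (i := i).
have sG a b : smooth_on (img i) (fun x => g i x a b).
  by apply: smooth_on_entry => //; exact: metric_smooth.
have uG x : img i x -> g i x \in unitmx by exact: metric_nondeg.
have GbarE u a b : (@xpart R n @^-1` img i) u -> T2_metric g i u a b =
    frob (weight a * weight b * prolong (fun x => g i x (base a) (base b)) u).
  exact: T2_metricE.
have oUb := open_xpart_preimage oU.
have sGb := smooth_Gbar oU sG GbarE.
have uGb := Gbar_unit oU sG uG GbarE.
apply: (iff_trans (semi_symmetric_onP oUb sGb uGb)).
apply: (iff_trans (prolonged_semi_symmetricP oU sG uG GbarE)).
exact: iff_sym (semi_symmetric_onP oU sG uG).
Qed.

End SecondOrderCharts.

Theorem theorem1 (R : realType) (n : nat) (hn : (3 <= n)%N)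
    (M : atlas R n) (hM : is_manifold M)
    (g : matrices M) (hg : is_pseudo_riemannian g) :
  semi_symmetric (T2_metric g) <-> semi_symmetric g.
Proof.
have T2P i := semi_symmetric_on_T2 hM i hg.
split=> h i; first by apply/T2P; rewrite -img_T2//; exact: h.
suff : semi_symmetric_on (@img R (n + n + n) (T2 M) i) (T2_metric g i) by [].
by rewrite img_T2//; apply/T2P; exact: h.
Qed.
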